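(* Work in $\mathsf{ZF}$. Let $\kappa$ be an infinite cardinal and let $\mathcal{C}$ be the class of cardinals $\mu$ with $\operatorname{cf}(\mu)=\operatorname{cf}(\kappa)$. The following are equivalent: (1) $\neg\mathsf{EC}_{\kappa}$; (2) for all $\mu\in\mathcal{C}$, $\neg\mathsf{EC}_{\mu}$; (3) for some $\mu\in\mathcal{C}$, $\neg\mathsf{EC}_{\mu}$; (4) there is a limit cardinal $\mu\in\mathcal{C}$ and a set $X$ such that $\aleph(X)=\mu$; (5) there is $\mu\in\mathcal{C}$ and a set $X$ such that $\aleph(X)=\mu<\aleph^\ast(X)$; and (6) there is $\mu^\ast\in\mathcal{C}$ such that for all limit cardinals $\mu\in\mathcal{C}\setminus\mu^\ast$ (that is, $\mu\in\mathcal{C}$ with $\mu\geq\mu^\ast$) there is a set $X$ such that $\aleph(X)=\mu$.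
   Context: The base theory is $\mathsf{ZF}$ (no axiom of choice). ''Cardinal'' means an initial ordinal; $\aleph_0$ counts as a limit cardinal. $|X|\leq|Y|$ means there is an injection $X\to Y$; $|X|\leq^\ast|Y|$ means there is a surjection $Y\to X$ or $X=\emptyset$. The Hartogs number $\aleph(X)$ is the least ordinal $\alpha$ such that $|\alpha|\nleq|X|$; the Lindenbaum number $\aleph^\ast(X)$ is the least ordinal $\alpha$ such that $|\alpha|\nleq^\ast|X|$. A selector for a function $F$ is a function $f$ with $\operatorname{dom}(f)=\operatorname{dom}(F)$ and $f(a)\in F(a)$ for all $a\in\operatorname{dom}(F)$. For an ordinal $\alpha$, a function $F$ with domain $\alpha$ is $\alpha$-approachable if $F(\beta)\neq\emptyset$ for all $\beta<\alpha$ and, for every $\beta<\alpha$, $F\upharpoonright\beta$ has a selector. Extendable choice $\mathsf{EC}_\alpha$ is the statement that every $\alpha$-approachable function has a selector. *)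

(* Defs.v *)
(* A theorem of ZF is stated as a property of an arbitrary model [V] of
   first-order ZF.  The Separation and Replacement schemes range over formulas
   of the language of set theory (with parameters), not over all Rocq
   predicates on [V]: the latter would make [V] a model of second-order ZF, so
   that choice in the metatheory would give choice in [V].  Every set-theoretic
   notion below quantifies over elements of [V] only. *)

From mathcomp Require Import all_boot.

Set Implicit Arguments.
Unset Strict Implicit.
Unset Printing Implicit Defensive.

Record set_structure : Type := SetStructure {
  carrier :> Type;
  elt : carrier -> carrier -> Prop }.

Declare Scope zf_scope.
Delimit Scope zf_scope with zf.
Notation "x ∈ y" := (elt x y) (at level 70, no associativity) : zf_scope.
Local Open Scope zf_scope.

(* Variables are de Bruijn indices.  Satisfaction is classical, so falsity,
   implication and universal quantification suffice. *)
Inductive formula : Type :=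
| FElt of nat & nat
| FEq of nat & nat
| FFalse
| FImp of formula & formula
| FAll of formula.

Definition scons (T : Type) (x : T) (e : nat -> T) : nat -> T :=
  fun n => if n is m.+1 then e m else x.

Fixpoint sat (V : set_structure) (e : nat -> V) (phi : formula) : Prop :=
  match phi with
  | FElt i j => e i ∈ e j
  | FEq i j => e i = e j
  | FFalse => False
  | FImp phi1 phi2 => sat e phi1 -> sat e phi2
  | FAll phi1 => forall x : V, sat (scons x e) phi1
  end.

Section SetTheory.
Context {V : set_structure}.
Implicit Types (x y z a b f F G X Y s d : V) (α β γ δ η κ μ θ n : V).

Definition subset x y : Prop := forall z, z ∈ x -> z ∈ y.
Definition is_empty x : Prop := forall z, ~ z ∈ x.
Definition nonempty x : Prop := exists z, z ∈ x.
Definition is_upair z x y : Prop := forall w : V, w ∈ z <-> w = x \/ w = y.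
Definition is_succ y x : Prop := forall z, z ∈ y <-> z ∈ x \/ z = x.

(* Kuratowski pair *)
Definition is_pair z x y : Prop :=
  exists a b, [/\ is_upair a x x, is_upair b x y & is_upair z a b].

Definition app F x y : Prop := exists p : V, is_pair p x y /\ p ∈ F.

Definition is_function F : Prop :=
  (forall p : V, p ∈ F -> exists x y, is_pair p x y) /\
  (forall x y z, app F x y -> app F x z -> y = z).

Definition is_dom F d : Prop := forall x, x ∈ d <-> exists y, app F x y.

Definition function_on F d : Prop := is_function F /\ is_dom F d.

Definition function_from_to F X Y : Prop :=
  function_on F X /\ forall x y, app F x y -> y ∈ Y.

Definition is_injection F X Y : Prop :=
  function_from_to F X Y /\
  forall x y z, app F x z -> app F y z -> x = y.

Definition is_surjection F X Y : Prop :=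
  function_from_to F X Y /\ forall y, y ∈ Y -> exists x, app F x y.

Definition is_bijection F X Y : Prop :=
  is_injection F X Y /\ is_surjection F X Y.

Definition is_restriction G F d : Prop :=
  forall p : V, p ∈ G <-> p ∈ F /\ exists x y, x ∈ d /\ is_pair p x y.

Definition card_eq X Y : Prop := exists F, is_bijection F X Y.
Definition card_le X Y : Prop := exists F, is_injection F X Y.
Definition card_le_star X Y : Prop :=
  (exists F, is_surjection F Y X) \/ is_empty X.

Definition is_transitive x : Prop := forall y, y ∈ x -> subset y x.

Definition well_ordered_by_elt x : Prop :=
  [/\ forall y, y ∈ x -> ~ y ∈ y,
      forall a b d, a ∈ x -> b ∈ x -> d ∈ x -> a ∈ b -> b ∈ d -> a ∈ d
    & forall s, subset s x -> nonempty s ->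
        exists a, a ∈ s /\ forall b, b ∈ s -> a = b \/ a ∈ b].

Definition is_ordinal α : Prop := is_transitive α /\ well_ordered_by_elt α.

Definition ord_le α β : Prop := α ∈ β \/ α = β.

Definition least_ordinal (P : V -> Prop) α : Prop :=
  [/\ is_ordinal α, P α & forall β, is_ordinal β -> P β -> ord_le α β].

Definition is_natural n : Prop :=
  is_ordinal n /\
  forall x, ord_le x n -> is_empty x \/ exists y, is_succ x y.

Definition is_finite X : Prop := exists n, is_natural n /\ card_eq n X.

Definition is_cardinal κ : Prop :=
  is_ordinal κ /\ forall α, α ∈ κ -> ~ card_eq α κ.

Definition infinite_cardinal κ : Prop := is_cardinal κ /\ ~ is_finite κ.

(* α ranges over finite cardinals too, so ℵ_0 qualifies. *)
Definition limit_cardinal μ : Prop :=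
  infinite_cardinal μ /\
  forall α, α ∈ μ -> is_cardinal α ->
    exists β, [/\ β ∈ μ, is_cardinal β & α ∈ β].

Definition is_cofinal_map f β α : Prop :=
  function_from_to f β α /\
  forall γ, γ ∈ α -> exists δ η, app f δ η /\ ord_le γ η.

Definition is_cof α β : Prop :=
  least_ordinal (fun γ => exists f, is_cofinal_map f γ α) β.

Definition in_cof_class κ μ : Prop :=
  is_cardinal μ /\ exists θ, is_cof μ θ /\ is_cof κ θ.

Definition is_Hartogs X α : Prop :=
  least_ordinal (fun β => ~ card_le β X) α.

Definition is_Lindenbaum X α : Prop :=
  least_ordinal (fun β => ~ card_le_star β X) α.

Definition is_selector f F : Prop :=
  exists d, [/\ function_on F d, function_on f d
    & forall a y z, app f a y -> app F a z -> y ∈ z].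

Definition approachable α F : Prop :=
  [/\ function_on F α,
      forall β y, app F β y -> nonempty y
    & forall β, β ∈ α ->
        exists G, is_restriction G F β /\ exists f, is_selector f G].

Definition EC α : Prop :=
  forall F, approachable α F -> exists f, is_selector f F.

End SetTheory.

Record ZF (V : set_structure) : Prop := {
  ZF_extensionality :
    forall x y : V, (forall z : V, z ∈ x <-> z ∈ y) -> x = y;
  ZF_foundation :
    forall x : V, nonempty x ->
      exists y : V, y ∈ x /\ forall z : V, z ∈ y -> ~ z ∈ x;
  ZF_pairing :
    forall x y : V, exists z : V, is_upair z x y;
  ZF_union :
    forall x : V, exists u : V, forall z : V,
      z ∈ u <-> exists y : V, y ∈ x /\ z ∈ y;
  ZF_powerset :
    forall x : V, exists p : V, forall z : V, z ∈ p <-> subset z x;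
  ZF_infinity :
    exists i : V, (exists x : V, x ∈ i /\ is_empty x) /\
      forall x : V, x ∈ i -> exists y : V, y ∈ i /\ is_succ y x;
  ZF_separation :
    forall (phi : formula) (e : nat -> V) (x : V),
      exists y : V, forall z : V, z ∈ y <-> z ∈ x /\ sat (scons z e) phi;
  (* variable 0 is the value, variable 1 the argument *)
  ZF_replacement :
    forall (phi : formula) (e : nat -> V) (a : V),
      (forall x y z : V, x ∈ a ->
         sat (scons y (scons x e)) phi -> sat (scons z (scons x e)) phi ->
         y = z) ->
      exists b : V, forall y : V,
        y ∈ b <-> exists x : V, x ∈ a /\ sat (scons y (scons x e)) phi }.

(* Main.v *)
Require Import Defs.
From mathcomp Require Import all_boot.
From Stdlib Require Import Classical ClassicalEpsilon.

(** Extendable choice depends on [κ] only through its cofinality. If [k] is a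
    nondecreasing cofinal map from [μ] to [κ], a selector for a [κ]-approachable
    [F] can be assembled from selectors of [F] up to [k β], for [β] in [μ]; the
    sets of these form a [μ]-approachable family, since one long selector serves
    all smaller [β] (lemma [EC_climbs]). Equal cofinalities provide such maps in
    both directions ([cof_climbs]), and this settles the equivalence of the first
    three clauses.

    A Hartogs number [μ] of [X] refutes [EC μ] in two situations. If [μ] is a
    limit cardinal, [EC μ] would choose injections into [X] of all smaller
    ordinals at once, and the union of their ranges would contain a copy of [μ]
    ([Hartogs_limit_not_EC]). If [X] maps onto [μ], then [EC μ] would choose points
    of [X] with cofinal images in [μ], and, [μ] being now a successor, also
    injections of all smaller ordinals into the predecessor; either there are [μ]
    many points, or [μ] is too small a union
    ([Hartogs_Lindenbaum_not_EC]).

    Conversely let [F] be approachable on [κ] without selector, and let [μ] be a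
    large cardinal of the same cofinality. The triples of an index [β], a selector
    of [F] up to [β], and an ordinal below [k β], where [k] climbs from [κ] to [μ],
    form a set that maps onto [μ] and whose Hartogs number is [μ]
    ([not_EC_Hartogs]). Limit cardinals of the given cofinality are unbounded
    ([limit_cardinal_above]), so this gives the remaining clauses.

    The structure [V] satisfies separation and replacement for formulas only.
    Every set is therefore built by definite description, for which definability
    with parameters can be read off the syntax (tactic [definable]). Functions of
    the model are then handled as definable maps [V -> V], to which replacement
    applies. The arguments use products of infinite well-ordered cardinals, hence
    Hessenberg's theorem ([hessenberg]), and recursion only along a set
    ([wf_recursion]). *)

Set Implicit Arguments.
Unset Strict Implicit.
Unset Printing Implicit Defensive.

Local Open Scope zf_scope.

Create HintDb definable.

Section ZFSetTheory.
Context {V : set_structure} (hV : ZF V).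

(** * Definability with parameters *)

Section Definability.
Implicit Types (P Q : (nat -> V) -> Prop) (e p : nat -> V).
Implicit Types (t : (nat -> V) -> V) (r : nat -> nat) (phi : formula).

Definition ren_up r (n : nat) : nat := if n is m.+1 then (r m).+1 else 0.

Fixpoint ren r phi : formula :=
  match phi with
  | FElt i j => FElt (r i) (r j)
  | FEq i j => FEq (r i) (r j)
  | FFalse => FFalse
  | FImp a b => FImp (ren r a) (ren r b)
  | FAll a => FAll (ren (ren_up r) a)
  end.

Lemma sat_ren phi : forall r e e', (forall n, e' n = e (r n)) ->
  sat e (ren r phi) <-> sat e' phi.
Proof.
elim: phi => [i j|i j||a IHa b IHb|a IHa] r e e' E //=; rewrite ?E //.
  by rewrite (IHa r e e') // (IHb r e e').
by split=> H x; have := H x; apply IHa => -[|n] /=.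
Qed.

(** Even variables are free, odd ones hold the parameters: both supplies are
    then infinite, and merging the parameters of two formulas is a renaming. *)
Definition alt (T : Type) (a b : nat -> T) (n : nat) : T :=
  if odd n then b n./2 else a n./2.

Lemma alt0 T (a b : nat -> T) n : alt a b n.*2 = a n.
Proof. by rewrite /alt odd_double doubleK. Qed.

Lemma alt1 T (a b : nat -> T) n : alt a b n.*2.+1 = b n.
Proof. by rewrite /alt /= odd_double /= uphalf_double. Qed.

Definition altE := (alt0, alt1).

(** Predicates of environments rather than of single sets, so that definability
    passes under quantifiers; the parameters do not depend on [e]. *)
Definition dfn P : Prop :=
  exists phi p, forall e, P e <-> sat (alt e p) phi.

Lemma alt_ren T (a b c : nat -> T) r s :
  (forall n, a n = c (r n)) -> (forall n, b n = c (s n)) ->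
  forall n, alt a b n = c (alt r s n).
Proof. by move=> Ea Eb n; rewrite /alt; case: odd. Qed.

Lemma dfn_ext P Q : (forall e, P e <-> Q e) -> dfn P -> dfn Q.
Proof. by move=> E [phi [p H]]; exists phi, p => e; rewrite -E. Qed.

Lemma zf_inhabited : inhabited V.
Proof. by have [i _] := ZF_infinity hV. Qed.

Lemma dfn_false : dfn (fun=> False).
Proof. by case: zf_inhabited => c; exists FFalse, (fun=> c). Qed.

Lemma dfn_imp P Q : dfn P -> dfn Q -> dfn (fun e => P e -> Q e).
Proof.
move=> [phi [p HP]] [psi [q HQ]].
pose r s := alt (fun n => n.*2) (fun n => (s n).*2.+1).
exists (FImp (ren (r (fun n => n.*2)) phi) (ren (r (fun n => n.*2.+1)) psi)).
exists (alt p q) => e /=.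
rewrite (@sat_ren phi _ _ (alt e p)); last by apply: alt_ren => n; rewrite !altE.
rewrite (@sat_ren psi _ _ (alt e q)); last by apply: alt_ren => n; rewrite !altE.
by rewrite HP HQ.
Qed.

Lemma dfn_const (A : Prop) : dfn (fun=> A).
Proof.
have [a|na] := classic A.
  by apply: dfn_ext (dfn_imp dfn_false dfn_false).
by apply: dfn_ext dfn_false.
Qed.

Lemma dfn_var P r : dfn P -> dfn (fun e => P (fun n => e (r n))).
Proof.
move=> [phi [p HP]].
exists (ren (alt (fun n => (r n).*2) (fun n => n.*2.+1)) phi), p => e.
rewrite (@sat_ren phi _ _ (alt (fun n => e (r n)) p)) //.
by apply: alt_ren => n; rewrite !altE.
Qed.

(** Turns a variable into a parameter. *)
Lemma dfn_inst P c : dfn P -> dfn (fun e => P (scons c e)).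
Proof.
move=> [phi [p HP]].
pose r0 n := if n is m.+1 then m.*2 else 1.
exists (ren (alt r0 (fun n => n.+1.*2.+1)) phi), (scons c p) => e.
rewrite (@sat_ren phi _ _ (alt (scons c e) p)) //.
by apply: alt_ren => -[|n] //; rewrite ?altE.
Qed.

Lemma dfn_forall (P : V -> (nat -> V) -> Prop) :
  dfn (fun e => P (e 0) (fun n => e n.+1)) -> dfn (fun e => forall x, P x e).
Proof.
move=> [phi [p HP]].
pose r0 n := if n is m.+1 then m.*2.+1 else 0.
exists (FAll (ren (alt r0 (fun n => n.*2.+2)) phi)), p => e /=.
have E x : sat (scons x (alt e p)) (ren (alt r0 (fun n => n.*2.+2)) phi) <->
   P x e.
  rewrite (@sat_ren phi _ _ (alt (scons x e) p)); first by rewrite -HP.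
  by apply: alt_ren => -[|n] //=; rewrite ?altE.
by split=> H x; move: (H x); rewrite E.
Qed.

Lemma dfn_not P : dfn P -> dfn (fun e => ~ P e).
Proof. by move=> dP; apply: dfn_imp dP dfn_false. Qed.

Lemma dfn_or P Q : dfn P -> dfn Q -> dfn (fun e => P e \/ Q e).
Proof.
move=> dP dQ; apply: dfn_ext (dfn_imp (dfn_not dP) dQ) => e.
by split; [have [|] := classic (P e); tauto | tauto].
Qed.

Lemma dfn_and P Q : dfn P -> dfn Q -> dfn (fun e => P e /\ Q e).
Proof.
move=> dP dQ; apply: dfn_ext (dfn_not (dfn_imp dP (dfn_not dQ))) => e.
by split; [have [|] := classic (P e); have [|] := classic (Q e); tauto | tauto].
Qed.

Lemma dfn_and3 P Q R : dfn P -> dfn Q -> dfn R ->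
  dfn (fun e => [/\ P e, Q e & R e]).
Proof.
move=> dP dQ dR; apply: dfn_ext (dfn_and dP (dfn_and dQ dR)) => e.
by split; [move=> [? []] | move=> []].
Qed.

Lemma dfn_iff P Q : dfn P -> dfn Q -> dfn (fun e => P e <-> Q e).
Proof. by move=> dP dQ; apply: dfn_and; apply: dfn_imp. Qed.

Lemma dfn_exists (P : V -> (nat -> V) -> Prop) :
  dfn (fun e => P (e 0) (fun n => e n.+1)) -> dfn (fun e => exists x, P x e).
Proof.
move=> dP.
apply: dfn_ext (dfn_not (dfn_forall (P := fun x e => ~ P x e) (dfn_not dP))).
by move=> e; split; [apply: not_all_not_ex | move=> [x ?] /(_ x)].
Qed.

Lemma dfn_elt_var i j : dfn (fun e => e i ∈ e j).
Proof.
case: zf_inhabited => c; exists (FElt i.*2 j.*2), (fun=> c) => e /=.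
by rewrite !altE.
Qed.

Lemma dfn_eq_var i j : dfn (fun e => e i = e j).
Proof.
case: zf_inhabited => c; exists (FEq i.*2 j.*2), (fun=> c) => e /=.
by rewrite !altE.
Qed.

(** A term is definable when its graph is; variable 0 is the value. *)
Definition dterm t : Prop := dfn (fun e => e 0 = t (fun n => e n.+1)).

Definition def1 (R : V -> Prop) := dfn (fun e => R (e 0)).
Definition def2 (R : V -> V -> Prop) := dfn (fun e => R (e 0) (e 1)).
Definition def3 (R : V -> V -> V -> Prop) := dfn (fun e => R (e 0) (e 1) (e 2)).

Definition fdef1 (F : V -> V) := dterm (fun e => F (e 0)).
Definition fdef2 (F : V -> V -> V) := dterm (fun e => F (e 0) (e 1)).

Lemma dterm_var i : dterm (fun e => e i).
Proof. exact: dfn_eq_var. Qed.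

Lemma dterm_const c : dterm (fun=> c).
Proof. exact: (dfn_inst c (dfn_eq_var 1 0)). Qed.

Lemma dterm_up t : dterm t -> dfn (fun e => e 0 = t (fun n => e n.+2)).
Proof. exact: (dfn_var (fun n => if n is m.+1 then m.+2 else 0)). Qed.

Lemma dfn_app1 (R : V -> Prop) t : def1 R -> dterm t -> dfn (fun e => R (t e)).
Proof.
move=> dR dt; apply: (@dfn_ext (fun e => exists x, x = t e /\ R x)).
  by move=> e; split=> [[x [->]]|?] //; exists (t e).
by apply: dfn_exists; apply: dfn_and.
Qed.

Lemma dfn_app2 (R : V -> V -> Prop) s t :
  def2 R -> dterm s -> dterm t -> dfn (fun e => R (s e) (t e)).
Proof.
move=> dR ds dt.
apply: (@dfn_ext (fun e => exists x, x = s e /\ exists y, y = t e /\ R x y)).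
  by move=> e; split=> [[x [-> [y [->]]]]|?] //; exists (s e); split; last exists (t e).
apply: dfn_exists; apply: dfn_and; first exact: ds.
apply: dfn_exists; apply: dfn_and; first exact: dterm_up.
exact: (dfn_var (fun n => if n is m.+1 then if m is k.+1 then k.+2 else 0 else 1) dR).
Qed.

Lemma dfn_app3 (R : V -> V -> V -> Prop) s t u :
  def3 R -> dterm s -> dterm t -> dterm u -> dfn (fun e => R (s e) (t e) (u e)).
Proof.
move=> dR ds dt du.
apply: (@dfn_ext (fun e => exists x, x = s e /\ exists y, y = t e /\
                           exists z, z = u e /\ R x y z)).
  move=> e; split=> [[x [-> [y [-> [z [->]]]]]]|?] //.
  by exists (s e); split; last exists (t e); split; last exists (u e).
apply: dfn_exists; apply: dfn_and; first exact: ds.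
apply: dfn_exists; apply: dfn_and; first exact: dterm_up.
apply: dfn_exists; apply: dfn_and.
  exact: (dfn_var (fun n => if n is m.+1 then m.+3 else 0) du).
exact: (dfn_var (fun n => 2 - n) dR).
Qed.

Lemma dterm_app1 F t : fdef1 F -> dterm t -> dterm (fun e => F (t e)).
Proof.
move=> dF dt; rewrite /dterm.
apply: (@dfn_app2 (fun y x => y = F x)) => //; first exact: dterm_var.
exact: dterm_up.
Qed.

Lemma dterm_app2 F s t :
  fdef2 F -> dterm s -> dterm t -> dterm (fun e => F (s e) (t e)).
Proof.
move=> dF ds dt; rewrite /dterm.
apply: (@dfn_app3 (fun z x y => z = F x y)); [| |exact: dterm_up..].
  exact: dF.
exact: dterm_var.
Qed.

Lemma def_eq : def2 (fun x y => x = y).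
Proof. exact: dfn_eq_var. Qed.

Lemma def_elt : def2 (@elt V).
Proof. exact: dfn_elt_var. Qed.

Lemma empty_exists : exists x : V, is_empty x.
Proof. by have [i [[x []]]] := ZF_infinity hV; exists x. Qed.

Definition describes (P : V -> Prop) (y : V) :=
  P y /\ forall z, P z -> z = y.

(** Definite description with a fixed value, the empty set, in the improper
    case: whatever [P] is, its graph is then definable as soon as [P] is. *)
Definition iota (P : V -> Prop) : V :=
  epsilon zf_inhabited (fun y => describes P y \/
    (~ (exists z, describes P z) /\ is_empty y)).

Lemma iota_spec (P : V -> Prop) : describes P (iota P) \/
    (~ (exists z, describes P z) /\ is_empty (iota P)).
Proof.
apply: (@epsilon_spec V zf_inhabited (fun y => describes P y \/
    (~ (exists z, describes P z) /\ is_empty y))).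
have [[z Pz]|n] := classic (exists z, describes P z); first by exists z; left.
by have [x x0] := empty_exists; exists x; right.
Qed.

Lemma iotaE (P : V -> Prop) y : P y -> (forall z, P z -> z = y) -> iota P = y.
Proof.
move=> Py uP; case: (iota_spec P) => [[Pi _]|[n _]]; first exact: uP.
by case: n; exists y.
Qed.

Lemma iotaP (P : V -> Prop) : (exists y, P y) -> (forall y z, P y -> P z -> y = z) ->
  P (iota P).
Proof. by move=> [y Py] uP; rewrite (@iotaE P y) // => z Pz; apply: uP. Qed.

Lemma is_empty_inj (x y : V) : is_empty x -> is_empty y -> x = y.
Proof.
by move=> ex ey; apply: (ZF_extensionality hV) => z; split=> [/ex|/ey].
Qed.

Lemma dterm_iota (P : V -> (nat -> V) -> Prop) :
  dfn (fun e => P (e 0) (fun n => e n.+1)) ->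
  dterm (fun e => iota (fun y => P y e)).
Proof.
move=> dP.
have dP' i (h : nat -> nat) : dfn (fun e => P (e i) (fun n => e (h n))).
  exact: (dfn_var (fun n => if n is m.+1 then h m else i) dP).
pose D y e := P y e /\ forall z, P z e -> z = y.
have dD i (h : nat -> nat) : dfn (fun e => D (e i) (fun n => e (h n))).
  apply: dfn_and => //; apply: dfn_forall; apply: dfn_imp; first exact: dP'.
  exact: dfn_eq_var.
apply: (@dfn_ext (fun e => D (e 0) (fun n => e n.+1) \/
   (~ (exists z, D z (fun n => e n.+1)) /\ is_empty (e 0)))).
  move=> e /=; set Q := P^~ _; split=> [[[Py uP]|[n ey]]|->]; last exact: iota_spec.
    by rewrite (@iotaE Q (e 0)).
  by case: (iota_spec Q) => [d|[_ ?]]; [case: n; eexists; apply: d | apply: is_empty_inj].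
apply: dfn_or; first exact: dD.
apply: dfn_and; first by apply: dfn_not; apply: dfn_exists; apply: dD.
by apply: dfn_forall; apply: dfn_not; apply: dfn_elt_var.
Qed.

Lemma separation (P : V -> Prop) (A : V) : def1 P ->
  exists y, forall z, z ∈ y <-> z ∈ A /\ P z.
Proof.
move=> [phi [p HP]].
have [y Hy] := ZF_separation hV (ren (alt (fun=> 0) S) phi) p A.
exists y => z; rewrite Hy (@sat_ren phi _ _ (alt (fun=> z) p)) -?(HP (fun=> z)) //.
by apply: alt_ren.
Qed.

Lemma replacement (F : V -> V) (A : V) : fdef1 F ->
  exists y, forall z, z ∈ y <-> exists x, x ∈ A /\ z = F x.
Proof.
move=> [phi [p HF]].
pose r := alt (fun n => if n is m.+1 then 1 else 0) (fun n => n.+2).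
have E x y : sat (scons y (scons x p)) (ren r phi) <-> y = F x.
  rewrite (@sat_ren phi _ _ (alt (fun n => if n is m.+1 then x else y) p)).
    by rewrite -HF.
  by apply: alt_ren => -[|n].
have [x y z _ /E-> /E-> //|y Hy] := @ZF_replacement _ hV (ren r phi) p A.
by exists y => z; rewrite Hy; split=> -[x [xA Ex]]; exists x; split=> //; apply/E.
Qed.

End Definability.

(** * Set operations *)

Definition upair (a b : V) : V := iota (fun z => is_upair z a b).
Definition opair (a b : V) : V := upair (upair a a) (upair a b).
Definition pr1 (p : V) : V := iota (fun x => exists y, p = opair x y).
Definition pr2 (p : V) : V := iota (fun y => exists x, p = opair x y).
Definition bigU (x : V) : V :=
  iota (fun u => forall z, z ∈ u <-> exists y, y ∈ x /\ z ∈ y).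
Definition pow (x : V) : V := iota (fun p => forall z, z ∈ p <-> Defs.subset z x).
Definition sep (A : V) (P : V -> Prop) : V :=
  iota (fun y => forall z, z ∈ y <-> z ∈ A /\ P z).
Definition img (A : V) (F : V -> V) : V :=
  iota (fun y => forall z, z ∈ y <-> exists x, x ∈ A /\ z = F x).
Definition lam (A : V) (F : V -> V) : V := img A (fun x => opair x (F x)).
Definition ap (f x : V) : V := iota (fun y => opair x y ∈ f).
Definition cross (A B : V) : V := bigU (img A (fun a => img B (opair a))).
Definition cup (x y : V) : V := bigU (upair x y).
Definition suc (x : V) : V := cup x (upair x x).
Definition cond (P : Prop) (a b : V) : V :=
  iota (fun y => P /\ y = a \/ ~ P /\ y = b).
Definition least (P : V -> Prop) : V := iota (least_ordinal P).

#[local] Hint Resolve def_eq def_elt : definable.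

Ltac def_leaf :=
  solve [assumption | auto 2 with definable nocore].

Ltac definable1 :=
  cbv beta;
  match goal with
  | |- dfn (fun e => ?A) => exact (dfn_const A)
  | |- dfn (fun e => @?A e /\ @?B e) => refine (dfn_and (P:=A) (Q:=B) _ _)
  | |- dfn (fun e => @?A e \/ @?B e) => refine (dfn_or (P:=A) (Q:=B) _ _)
  | |- dfn (fun e => @?A e <-> @?B e) => refine (dfn_iff (P:=A) (Q:=B) _ _)
  | |- dfn (fun e => ~ @?A e) => refine (dfn_not (P:=A) _)
  | |- dfn (fun e => [/\ @?A e, @?B e & @?C e]) =>
      refine (dfn_and3 (P:=A) (Q:=B) (R:=C) _ _ _)
  | |- dfn (fun e => exists x, @?A e x) =>
      refine (dfn_exists (P:=fun x e => A e x) _)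
  | |- dfn (fun e => @?A e -> @?B e) => refine (dfn_imp (P:=A) (Q:=B) _ _)
  | |- dfn (fun e => forall x, @?A e x) =>
      refine (dfn_forall (P:=fun x e => A e x) _)
  | |- dfn (fun e => ?R (@?a e) (@?b e) (@?c e)) =>
      refine (dfn_app3 (R:=R) (s:=a) (t:=b) (u:=c) _ _ _ _); [def_leaf | ..]
  | |- dfn (fun e => ?R (@?a e) (@?b e)) =>
      refine (dfn_app2 (R:=R) (s:=a) (t:=b) _ _ _); [def_leaf | ..]
  | |- dfn (fun e => ?R (@?a e)) =>
      refine (dfn_app1 (R:=R) (t:=a) _ _); [def_leaf | ..]
  | |- dterm (fun e => ?c) => exact (dterm_const c)
  | |- dterm (fun e => e ?i) => exact (dterm_var i)
  | |- dterm (fun e => iota (@?P e)) =>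
      refine (dterm_iota (P:=fun y e => P e y) _)
  | |- dterm (fun e => sep (@?A e) (@?P e)) => unfold sep
  | |- dterm (fun e => img (@?A e) (@?P e)) => unfold img
  | |- dterm (fun e => lam (@?A e) (@?P e)) => unfold lam
  | |- dterm (fun e => cond (@?A e) (@?a e) (@?b e)) => unfold cond
  | |- dterm (fun e => least (@?P e)) =>
      unfold least, least_ordinal
  | |- dterm (fun e => ?F (@?a e) (@?b e)) =>
      refine (dterm_app2 (F:=F) (s:=a) (t:=b) _ _ _); [def_leaf | ..]
  | |- dterm (fun e => ?F (@?a e)) =>
      refine (dterm_app1 (F:=F) (t:=a) _ _); [def_leaf | ..]
  | |- dfn (fun e => least_ordinal (@?P e) _) =>
      unfold least_ordinal
  | |- def1 _ => unfold def1
  | |- def2 _ => unfold def2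
  | |- def3 _ => unfold def3
  | |- fdef1 _ => unfold fdef1
  | |- fdef2 _ => unfold fdef2
  end.

(** Reads off the definability of a predicate or of a term from its syntax:
    predicates and operations are looked up in the hint database, and a subterm
    in which the environment does not occur is a parameter. *)
Ltac definable :=
  solve [assumption | auto 2 with definable nocore | repeat definable1].

Section DefinableNotions.

Lemma def_subset : def2 (@Defs.subset V).
Proof. rewrite /Defs.subset; definable. Qed.

Lemma def_is_upair : def3 (@is_upair V).
Proof. rewrite /is_upair; definable. Qed.
#[local] Hint Resolve def_subset def_is_upair : definable.

Lemma fdef_upair : fdef2 upair.
Proof. rewrite /upair; definable. Qed.
#[local] Hint Resolve fdef_upair : definable.

Lemma fdef_opair : fdef2 opair.
Proof. rewrite /opair; definable. Qed.
#[local] Hint Resolve fdef_opair : definable.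

Lemma fdef_pr1 : fdef1 pr1.
Proof. rewrite /pr1; definable. Qed.

Lemma fdef_pr2 : fdef1 pr2.
Proof. rewrite /pr2; definable. Qed.

Lemma fdef_bigU : fdef1 bigU.
Proof. rewrite /bigU; definable. Qed.
#[local] Hint Resolve fdef_bigU : definable.

Lemma fdef_ap : fdef2 ap.
Proof. rewrite /ap; definable. Qed.

Lemma fdef_cross : fdef2 cross.
Proof. rewrite /cross; definable. Qed.

Lemma fdef_cup : fdef2 cup.
Proof. rewrite /cup; definable. Qed.
#[local] Hint Resolve fdef_cup : definable.

Lemma fdef_suc : fdef1 suc.
Proof. rewrite /suc; definable. Qed.

Lemma def_is_pair : def3 (@is_pair V).
Proof. rewrite /is_pair; definable. Qed.
#[local] Hint Resolve def_is_pair : definable.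

Lemma def_app : def3 (@app V).
Proof. rewrite /app; definable. Qed.
#[local] Hint Resolve def_app : definable.

Lemma def_is_injection : def3 (@is_injection V).
Proof.
rewrite /is_injection /function_from_to /function_on /is_function /is_dom.
definable.
Qed.
#[local] Hint Resolve def_is_injection : definable.

Lemma def_is_surjection : def3 (@is_surjection V).
Proof.
rewrite /is_surjection /function_from_to /function_on /is_function /is_dom.
definable.
Qed.
#[local] Hint Resolve def_is_surjection : definable.

Lemma def_card_le : def2 (@card_le V).
Proof. rewrite /card_le; definable. Qed.

Lemma def_card_le_star : def2 (@card_le_star V).
Proof. rewrite /card_le_star /is_empty; definable. Qed.

Lemma def_card_eq : def2 (@card_eq V).
Proof. rewrite /card_eq /is_bijection; definable. Qed.
#[local] Hint Resolve def_card_eq : definable.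

Lemma def_is_ordinal : def1 (@is_ordinal V).
Proof.
rewrite /is_ordinal /is_transitive /well_ordered_by_elt /nonempty; definable.
Qed.
#[local] Hint Resolve def_is_ordinal : definable.

Lemma def_ord_le : def2 (@ord_le V).
Proof. rewrite /ord_le; definable. Qed.
#[local] Hint Resolve def_ord_le : definable.

Lemma def_is_finite : def1 (@is_finite V).
Proof. rewrite /is_finite /is_natural /is_empty /is_succ; definable. Qed.

Lemma def_is_cofinal_map : def3 (@is_cofinal_map V).
Proof.
rewrite /is_cofinal_map /function_from_to /function_on /is_function /is_dom.
definable.
Qed.

End DefinableNotions.

#[local] Hint Resolve def_subset def_is_upair fdef_upair fdef_opair
  fdef_pr1 fdef_pr2 fdef_bigU fdef_ap fdef_cross fdef_cup fdef_suc
  def_is_injection def_card_le def_card_le_star def_card_eq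
  def_is_ordinal def_ord_le def_is_finite def_is_cofinal_map
  : definable.

Section SetOperations.
Implicit Types (x y z a b A B f : V) (P : V -> Prop) (F : V -> V).

Lemma set_ext x y : (forall z, z ∈ x <-> z ∈ y) -> x = y.
Proof. exact: ZF_extensionality. Qed.

Lemma in_iota (Q : V -> Prop) :
  (exists y, forall z, z ∈ y <-> Q z) ->
  forall z, z ∈ iota (fun y => forall z, z ∈ y <-> Q z) <-> Q z.
Proof.
move=> ex; apply: (iotaP ex) => x y Hx Hy.
by apply: set_ext => z; rewrite Hx Hy.
Qed.

Lemma in_upair a b z : z ∈ upair a b <-> z = a \/ z = b.
Proof. by apply: in_iota; apply: ZF_pairing. Qed.

Lemma in_bigU x z : z ∈ bigU x <-> exists y, y ∈ x /\ z ∈ y.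
Proof. by apply: in_iota; apply: ZF_union. Qed.

Lemma in_pow x z : z ∈ pow x <-> Defs.subset z x.
Proof. by apply: in_iota; apply: ZF_powerset. Qed.

Lemma in_sep A P : def1 P -> forall z, z ∈ sep A P <-> z ∈ A /\ P z.
Proof. by move=> dP; apply: in_iota; apply: separation. Qed.

Lemma in_img A F : fdef1 F ->
  forall z, z ∈ img A F <-> exists x, x ∈ A /\ z = F x.
Proof. by move=> dF; apply: in_iota; apply: replacement. Qed.

Lemma in_cup x y z : z ∈ cup x y <-> z ∈ x \/ z ∈ y.
Proof.
rewrite in_bigU; split=> [[w []]|].
  by rewrite in_upair => -[->|->]; [left|right].
by case=> ?; [exists x|exists y]; rewrite in_upair; auto.
Qed.

Lemma in_suc x z : z ∈ suc x <-> z ∈ x \/ z = x.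
Proof. by rewrite in_cup in_upair; tauto. Qed.

Lemma is_succ_suc x y : is_succ y x <-> y = suc x.
Proof.
split=> [H|-> z]; last exact: in_suc.
by apply: set_ext => z; rewrite H in_suc.
Qed.

Lemma is_upairE z x y : is_upair z x y <-> z = upair x y.
Proof.
split=> [H|-> w]; last exact: in_upair.
by apply: set_ext => w; rewrite H in_upair.
Qed.

Lemma upair_inj a b c d : upair a b = upair c d ->
  a = c /\ b = d \/ a = d /\ b = c.
Proof.
move=> E.
have ab z : (z = a \/ z = b) <-> (z = c \/ z = d) by rewrite -!in_upair E.
have [/(_ (or_introl erefl)) ac _] := ab a.
have [/(_ (or_intror erefl)) bc _] := ab b.
have [_ /(_ (or_introl erefl)) ca] := ab c.
have [_ /(_ (or_intror erefl)) da] := ab d.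
case: ac bc ca da => [?|?] [?|?] [?|?] [?|?]; subst; auto.
Qed.

Lemma opair_inj a b c d : opair a b = opair c d -> a = c /\ b = d.
Proof.
move=> /upair_inj [] [] /upair_inj [] [E1 E2] /upair_inj [] [E3 E4]; subst; auto.
Qed.

Lemma is_pairE z x y : is_pair z x y <-> z = opair x y.
Proof.
split=> [[a [b []]]|->].
  by rewrite !is_upairE => -> -> ->.
by exists (upair x x), (upair x y); split; apply/is_upairE.
Qed.

Lemma appE f x y : app f x y <-> opair x y ∈ f.
Proof.
split=> [[p [/is_pairE ->]] //|xy].
by exists (opair x y); rewrite is_pairE.
Qed.

Lemma pr1E a b : pr1 (opair a b) = a.
Proof. by apply: iotaE => [|x [y /opair_inj []]]; first exists b. Qed.

Lemma pr2E a b : pr2 (opair a b) = b.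
Proof. by apply: iotaE => [|y [x /opair_inj []]]; first exists a. Qed.

Lemma in_cross A B z : z ∈ cross A B <->
  exists a b, [/\ a ∈ A, b ∈ B & z = opair a b].
Proof.
have d a : fdef1 (opair a) by definable.
rewrite in_bigU; split=> [[w []]|[a [b [aA bB ->]]]].
  rewrite in_img; last by definable.
  by move=> [a [aA ->]] /(in_img _ (d _)) [b [bB ->]]; exists a, b.
exists (img B (opair a)); rewrite in_img; last by definable.
by rewrite (in_img _ (d _)); split; [exists a | exists b].
Qed.

Lemma opair_cross A B a b : opair a b ∈ cross A B <-> a ∈ A /\ b ∈ B.
Proof.
rewrite in_cross; split=> [[x [y [xA yB /opair_inj [-> ->]]]] //|[aA bB]].
by exists a, b.
Qed.

Lemma app_lam A F : fdef1 F ->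
  forall x y, app (lam A F) x y <-> x ∈ A /\ y = F x.
Proof.
move=> dF x y; rewrite appE in_img; last by definable.
split=> [[z [zA /opair_inj [-> ->]]] //|[xA ->]].
by exists x.
Qed.

Lemma function_on_lam A F : fdef1 F -> function_on (lam A F) A.
Proof.
move=> dF; split; first split.
- move=> p; rewrite in_img; last by definable.
  by move=> [x [xA ->]]; exists x, (F x); rewrite is_pairE.
- by move=> x y z /(app_lam _ dF) [_ ->] /(app_lam _ dF) [_ ->].
- move=> x; split=> [xA|[y /(app_lam _ dF) []] //].
  by exists (F x); apply/app_lam.
Qed.

Lemma apE f x y : is_function f -> app f x y -> ap f x = y.
Proof.
move=> [_ uf] fxy; apply: iotaE => [|z]; first by rewrite -appE.
by rewrite -appE => fxz; apply: uf fxz fxy.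
Qed.

Lemma app_ap f d x : function_on f d -> x ∈ d -> app f x (ap f x).
Proof.
by move=> [ff df] /df [y fxy]; rewrite (apE ff fxy).
Qed.

Lemma ap_lam A F x : fdef1 F -> x ∈ A -> ap (lam A F) x = F x.
Proof.
move=> dF xA; apply: apE; first by case: (function_on_lam A dF).
by apply/app_lam.
Qed.

Lemma eq_img A F G : fdef1 F -> fdef1 G ->
  (forall x, x ∈ A -> F x = G x) -> img A F = img A G.
Proof.
move=> dF dG E; apply: set_ext => z; rewrite !in_img //.
by split=> -[x [xA ->]]; exists x; rewrite E.
Qed.

Lemma in_lam A F : fdef1 F ->
  forall z, z ∈ lam A F <-> exists x, x ∈ A /\ z = opair x (F x).
Proof. by move=> dF z; rewrite /lam in_img //; definable. Qed.

End SetOperations.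

(** * Functions of the model as definable maps *)

Section Maps.
Implicit Types (x y z a b A B C f α β γ δ : V) (P : V -> Prop) (F G s : V -> V).

Definition maps F A B := forall x, x ∈ A -> F x ∈ B.
Definition inj_on F A := forall x y, x ∈ A -> y ∈ A -> F x = F y -> x = y.
Definition onto F A B := forall y, y ∈ B -> exists x, x ∈ A /\ F x = y.
Definition inv_on A F y := iota (fun x => x ∈ A /\ F x = y).

Lemma fdef_inv_on A F : fdef1 F -> fdef1 (inv_on A F).
Proof. by move=> dF; rewrite /inv_on; definable. Qed.

Lemma inv_onK A F x : inj_on F A -> x ∈ A -> inv_on A F (F x) = x.
Proof. by move=> iF xA; apply: iotaE => // z [zA /iF]; apply. Qed.

Lemma inv_onP A B F y : inj_on F A -> onto F A B -> y ∈ B ->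
  inv_on A F y ∈ A /\ F (inv_on A F y) = y.
Proof. by move=> iF oF /oF [x [xA <-]]; rewrite inv_onK. Qed.

Lemma lam_from_to A B F : fdef1 F -> maps F A B ->
  function_from_to (lam A F) A B.
Proof.
move=> dF mF; split; first exact: function_on_lam.
by move=> x y /(app_lam _ dF) [/mF + ->].
Qed.

Lemma ap_from_to f A B : function_from_to f A B -> maps (ap f) A B.
Proof. by move=> [fA fB] x xA; apply: fB (app_ap fA xA). Qed.

Lemma lam_injection A B F : fdef1 F -> maps F A B -> inj_on F A ->
  is_injection (lam A F) A B.
Proof.
move=> dF mF iF; split; first exact: lam_from_to.
move=> x y z /(app_lam _ dF) [xA ->] /(app_lam _ dF) [yA E].
exact: iF.
Qed.

Lemma ap_inj_on f A B : is_injection f A B -> inj_on (ap f) A.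
Proof.
move=> [[fA _] If] x y xA yA E.
by apply: If (app_ap fA xA) _; rewrite E; apply: app_ap yA.
Qed.

Lemma lam_surjection A B F : fdef1 F -> maps F A B -> onto F A B ->
  is_surjection (lam A F) A B.
Proof.
move=> dF mF oF; split; first exact: lam_from_to.
by move=> y /oF [x [xA <-]]; exists x; apply/app_lam.
Qed.

Lemma ap_onto f A B : is_surjection f A B -> onto (ap f) A B.
Proof.
move=> [[[ff df] _] sf] y /sf [x fxy]; exists x.
by split; [apply/df; exists y | apply: apE].
Qed.

Lemma card_leI A B F : fdef1 F -> maps F A B -> inj_on F A -> card_le A B.
Proof. by move=> dF mF iF; exists (lam A F); apply: lam_injection. Qed.

Lemma card_leE A B : card_le A B ->
  exists F, [/\ fdef1 F, maps F A B & inj_on F A].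
Proof.
move=> [f If]; exists (ap f); split; first by definable.
  by apply: ap_from_to; case: If.
exact: ap_inj_on If.
Qed.

Lemma card_eqI A B F : fdef1 F -> maps F A B -> inj_on F A -> onto F A B ->
  card_eq A B.
Proof.
move=> dF mF iF oF; exists (lam A F).
by split; [apply: lam_injection | apply: lam_surjection].
Qed.

Lemma card_eqE A B : card_eq A B ->
  exists F, [/\ fdef1 F, maps F A B, inj_on F A & onto F A B].
Proof.
move=> [f [If Sf]]; exists (ap f); split; first by definable.
- by apply: ap_from_to; case: If.
- exact: ap_inj_on If.
- exact: ap_onto.
Qed.

Lemma card_eq_sym A B : card_eq A B -> card_eq B A.
Proof.
move=> /card_eqE [F [dF mF iF oF]].
have K := fun y => inv_onP (y:=y) iF oF.
apply: (card_eqI (fdef_inv_on A dF)).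
- by move=> y /K [].
- by move=> x y /K [_ {2}<-] /K [_ {2}<-] ->.
- by move=> x xA; exists (F x); rewrite inv_onK //; split=> //; apply: mF.
Qed.

Lemma card_eq_le A B : card_eq A B -> card_le A B.
Proof. by move=> /card_eqE [F [dF mF iF _]]; apply: card_leI iF. Qed.

Lemma card_eq_ge A B : card_eq A B -> card_le B A.
Proof. by move=> /card_eq_sym /card_eq_le. Qed.

Lemma card_le_subset A B : Defs.subset A B -> card_le A B.
Proof. by move=> AB; apply: (@card_leI A B id) => //; definable. Qed.

Lemma card_le_trans B A C : card_le A B -> card_le B C -> card_le A C.
Proof.
move=> /card_leE [F [dF mF iF]] /card_leE [G [dG mG iG]].
apply: (@card_leI A C (fun x => G (F x))); first by definable.
  by move=> x xA; apply/mG/mF.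
by move=> x y xA yA /iG E; apply: iF => //; apply: E; apply: mF.
Qed.

Lemma card_eq_trans B A C : card_eq A B -> card_eq B C -> card_eq A C.
Proof.
move=> /card_eqE [F [dF mF iF oF]] /card_eqE [G [dG mG iG oG]].
apply: (@card_eqI A C (fun x => G (F x))); first by definable.
- by move=> x xA; apply/mG/mF.
- by move=> x y xA yA /iG E; apply: iF => //; apply: E; apply: mF.
- by move=> z /oG [y [/oF [x [xA <-]] <-]]; exists x.
Qed.

Lemma card_le_cross A B C D : card_le A B -> card_le C D ->
  card_le (cross A C) (cross B D).
Proof.
move=> /card_leE [F [dF mF iF]] /card_leE [G [dG mG iG]].
apply: (@card_leI _ _ (fun p => opair (F (pr1 p)) (G (pr2 p)))).
- by definable.
- move=> _ /in_cross [a [c [aA cC ->]]].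
  by rewrite pr1E pr2E opair_cross; split; [apply: mF|apply: mG].
- move=> _ _ /in_cross [a [c [aA cC ->]]] /in_cross [a' [c' [aA' cC' ->]]].
  by rewrite !pr1E !pr2E => /opair_inj [/iF -> // /iG ->].
Qed.

Lemma card_le_starI A B F : fdef1 F -> maps F A B -> onto F A B ->
  card_le_star B A.
Proof. by move=> dF mF oF; left; exists (lam A F); apply: lam_surjection. Qed.

Lemma card_le_starE A B b : b ∈ B -> card_le_star B A ->
  exists F, [/\ fdef1 F, maps F A B & onto F A B].
Proof.
move=> bB [[f Sf]|/(_ b) //]; exists (ap f); split; first by definable.
  by apply: ap_from_to; case: Sf.
exact: ap_onto.
Qed.

Lemma cofinal_mapP β α : (exists f, is_cofinal_map f β α) <->
  exists F, [/\ fdef1 F, maps F β α &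
    forall γ, γ ∈ α -> exists δ, δ ∈ β /\ ord_le γ (F δ)].
Proof.
split=> [[f [[fβ fα] cf]]|[F [dF mF cF]]].
  exists (ap f); split; first by definable.
    exact: ap_from_to.
  move=> γ /cf [δ [η [fδη le]]]; exists δ; rewrite (apE _ fδη); last by case: fβ.
  by split=> //; case: fβ => _ ->; exists η.
exists (lam β F); split; first exact: lam_from_to.
by move=> γ /cF [δ [δβ le]]; exists δ, (F δ); rewrite app_lam.
Qed.

(** The form of extendable choice used below; for a transitive [α] it agrees
    with [EC] because every function of the model is a definable map and every
    definable map on a set is a function of the model. *)
Definition ext_choice α := forall F, fdef1 F ->
  (forall β, β ∈ α -> nonempty (F β)) ->
  (forall β, β ∈ α -> exists s, fdef1 s /\ forall γ, γ ∈ β -> s γ ∈ F γ) ->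
  exists s, fdef1 s /\ forall β, β ∈ α -> s β ∈ F β.

Lemma ECP α : is_transitive α -> EC α <-> ext_choice α.
Proof.
move=> tα; split=> [H F dF nF aF|H F [Fα nF aF]].
  have Fα := function_on_lam α dF.
  have [|f [d [[_ dF'] fd sel]]] := H (lam α F).
    split=> // [β y /(app_lam _ dF) [/nF ? ->] //|β βα].
    have [s [ds sF]] := aF β βα.
    exists (lam β F); split.
      move=> p; rewrite !in_lam //; split=> [[x [xβ ->]]|[[x [_ ->]] [x' [y [xβ]]]]].
        split; first by exists x; split=> //; apply: tα xβ.
        by exists x, (F x); split=> //; apply/is_pairE.
      by move/is_pairE/opair_inj => [-> _]; exists x'.
    exists (lam β s), β; split; [exact: function_on_lam.. |].
    by move=> a y z /(app_lam _ ds) [aβ ->] /(app_lam _ dF) [_ ->]; apply: sF.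
  exists (ap f); split=> [|β βα]; first by definable.
  apply: (sel β); last by apply/app_lam.
  apply: (app_ap fd); apply/dF'; exists (F β); exact/app_lam.
have dF : fdef1 (ap F) by definable.
have [β βα|β βα|s [ds sF]] := H (ap F) dF.
- exact: nF (app_ap Fα βα).
- have [G [rG [f [d [[_ dG] fd sel]]]]] := aF β βα.
  exists (ap f); split=> [|γ γβ]; first by definable.
  have Fγ := app_ap Fα (tα _ βα _ γβ).
  have Gγ : app G γ (ap F γ).
    apply/appE/rG; split; first exact/appE.
    by exists γ, (ap F γ); split=> //; apply/is_pairE.
  by apply: (sel _ _ _ _ Gγ); apply: (app_ap fd); apply/dG; exists (ap F γ).
- exists (lam α s), α; split=> //; first exact: function_on_lam.
  move=> a y z /(app_lam _ ds) [aα ->].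
  by move=> /(apE (proj1 Fα)) <-; apply: sF.
Qed.

End Maps.

(** * Ordinals *)

Section Ordinals.
Implicit Types (x y z a b s S α β γ δ ξ : V).

Lemma foundation x : nonempty x -> exists y, y ∈ x /\ forall z, z ∈ y -> ~ z ∈ x.
Proof. exact: ZF_foundation. Qed.

Lemma mem_irrefl x : ~ x ∈ x.
Proof.
have [|y [/in_upair yx H]] := @foundation (upair x x).
  by exists x; apply/in_upair; left.
have {yx} yx : y = x by case: yx.
by rewrite {}yx in H => xx; apply: (H x xx); apply/in_upair; left.
Qed.

Lemma mem_asym x y : x ∈ y -> ~ y ∈ x.
Proof.
move=> xy yx.
have [|z [/in_upair [->|->] H]] := @foundation (upair x y).
- by exists x; apply/in_upair; left.
- by apply: (H y yx); apply/in_upair; right.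
- by apply: (H x xy); apply/in_upair; left.
Qed.

Lemma ord_trans α β γ : is_ordinal α -> γ ∈ β -> β ∈ α -> γ ∈ α.
Proof. by move=> [tα _] γβ βα; apply: tα βα _ γβ. Qed.

Lemma ord_elt α β : is_ordinal α -> β ∈ α -> is_ordinal β.
Proof.
move=> oα βα; have [tα [_ wt wm]] := oα.
have sβ x : x ∈ β -> x ∈ α by move=> xβ; apply: ord_trans βα.
split.
  move=> δ δβ γ γδ; apply: (wt γ δ β) => //; last exact: sβ.
  exact: ord_trans (sβ _ δβ).
split=> [y _|a b d aβ bβ dβ|s ss]; first exact: mem_irrefl.
  by apply: wt; apply: sβ.
by apply: wm => x /ss /sβ.
Qed.

(** Unless [δ = α], the least element of [α] outside [δ] is [δ] itself. *)
Lemma ord_initial α δ : is_ordinal α -> is_transitive δ ->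
  Defs.subset δ α -> ord_le δ α.
Proof.
move=> oα tδ sδ; have [tα [_ wt wm]] := oα.
have total a b : a ∈ α -> b ∈ α -> [\/ a = b, a ∈ b | b ∈ a].
  move=> aα bα.
  have [|| z [/in_upair [->|->] H]] := wm (upair a b).
  - by move=> z /in_upair [->|->].
  - by exists a; apply/in_upair; left.
  - by case: (H b); [apply/in_upair; right|constructor 1|constructor 2].
  - by case: (H a); [apply/in_upair; left|constructor 1|constructor 3].
have dP : def1 (fun x => ~ x ∈ δ) by definable.
have [[x /(in_sep _ dP) [xα xδ]]|n] := classic (nonempty (sep α (fun x => ~ x ∈ δ))).
  left; have [||a [/(in_sep _ dP) [aα aδ] mina]] := wm (sep α (fun x => ~ x ∈ δ)).
  - by move=> z /(in_sep _ dP) [].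
  - by exists x; apply/in_sep.
  suff -> : δ = a by [].
  apply: set_ext => z; split=> [zδ|za].
    case: (total z a) => // [|E|az]; first exact: sδ.
      by case: aδ; rewrite -E.
    by case: aδ; apply: tδ az.
  have zα : z ∈ α by apply: ord_trans aα.
  apply: NNPP => zδ.
  have [|E|az] := mina z; first by apply/in_sep.
    by apply: (@mem_irrefl a); rewrite {1}E.
  exact: mem_asym az za.
right; apply: set_ext => z; split; first exact: sδ.
by move=> zα; apply: NNPP => zδ; apply: n; exists z; apply/in_sep.
Qed.

(** The intersection of [α] and [β] is an initial segment of both; it cannot
    belong to both, for it would then belong to itself. *)
Lemma ord_trichotomy α β : is_ordinal α -> is_ordinal β ->
  [\/ α ∈ β, α = β | β ∈ α].
Proof.
move=> oα oβ; pose δ := sep α (fun x => x ∈ β).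
have dP : def1 (fun x => x ∈ β) by definable.
have tδ : is_transitive δ.
  move=> y /(in_sep _ dP) [yα yβ] z zy.
  by apply/in_sep => //; split; apply: ord_trans zy _.
have [|δα|δα] := @ord_initial α δ oα tδ; first by move=> z /(in_sep _ dP) [].
- have [|δβ|δβ] := @ord_initial β δ oβ tδ; first by move=> z /(in_sep _ dP) [].
    by case: (@mem_irrefl δ); apply/in_sep.
  by constructor 3; rewrite -δβ.
- have [|δβ|δβ] := @ord_initial β δ oβ tδ; first by move=> z /(in_sep _ dP) [].
    by constructor 1; rewrite -δα.
  by constructor 2; rewrite -δα.
Qed.

Lemma ord_le_refl α : ord_le α α.
Proof. by right. Qed.

Lemma ord_le_lt_trans α β γ : is_ordinal γ -> ord_le α β -> β ∈ γ -> α ∈ γ.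
Proof. by move=> oγ [αβ|-> //]; apply: ord_trans αβ. Qed.

Lemma ord_lt_le_trans α β γ : is_ordinal γ -> α ∈ β -> ord_le β γ -> α ∈ γ.
Proof. by move=> oγ αβ [|<- //]; apply: ord_trans. Qed.

Lemma ord_le_trans β α γ : is_ordinal γ -> ord_le α β -> ord_le β γ -> ord_le α γ.
Proof. by move=> oγ [αβ|-> //] bc; left; apply: ord_lt_le_trans bc. Qed.

Lemma ord_le_notin α β : ord_le α β -> ~ β ∈ α.
Proof. by case=> [|->]; [apply: mem_asym | apply: mem_irrefl]. Qed.

Lemma ord_notin_le α β : is_ordinal α -> is_ordinal β -> ~ β ∈ α -> ord_le α β.
Proof. by move=> oα oβ n; case: (ord_trichotomy oα oβ) => // ?; [left|right]. Qed.

Lemma ord_leVlt α β : is_ordinal α -> is_ordinal β -> ord_le α β \/ β ∈ α.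
Proof. by move=> oα oβ; case: (ord_trichotomy oα oβ) => ?; [left; left|left; right|right]. Qed.

Lemma ord_le_anti α β : ord_le α β -> ord_le β α -> α = β.
Proof. by case=> // αβ [|-> //] /(mem_asym αβ). Qed.

Lemma ord_le_sub α β : is_ordinal β -> ord_le α β -> Defs.subset α β.
Proof. by move=> oβ le z za; apply: ord_lt_le_trans le. Qed.

Lemma ord_sub_le α β : is_ordinal α -> is_ordinal β -> Defs.subset α β -> ord_le α β.
Proof. by move=> [tα _] oβ; apply: ord_initial. Qed.

(** By foundation, only transitivity and trichotomy are left to check. *)
Lemma ord_of_ordinals α : is_transitive α ->
  (forall β, β ∈ α -> is_ordinal β) -> is_ordinal α.
Proof.
move=> tα oα; split=> //; split=> [y _|a b d _ _ dα|s ss ns]; first exact: mem_irrefl.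
  by apply: ord_trans; apply: oα.
have [a [as' mina]] := foundation ns.
exists a; split=> // b bs.
by case: (ord_trichotomy (oα _ (ss _ as')) (oα _ (ss _ bs))) => [|| /mina]; auto.
Qed.

Lemma ord_suc α : is_ordinal α -> is_ordinal (suc α).
Proof.
move=> oα; apply: ord_of_ordinals => [y|β] /in_suc [yα|->] //.
  by move=> z zy; apply/in_suc; left; apply: ord_trans yα.
  by move=> z zy; apply/in_suc; left.
exact: ord_elt yα.
Qed.

Lemma mem_suc α : α ∈ suc α.
Proof. by apply/in_suc; right. Qed.

Lemma suc_le α β : is_ordinal α -> β ∈ α -> ord_le (suc β) α.
Proof.
move=> oα βα; apply: ord_sub_le => //; first by apply/ord_suc/(ord_elt oα).
by move=> z /in_suc [zβ|-> //]; apply: ord_trans βα.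
Qed.

Lemma ord_bigU S : (forall x, x ∈ S -> is_ordinal x) -> is_ordinal (bigU S).
Proof.
move=> oS; apply: ord_of_ordinals => [y|y] /in_bigU [x [xS yx]].
  by move=> z zy; apply/in_bigU; exists x; split=> //; apply: ord_trans (oS x xS) zy yx.
exact: ord_elt (oS x xS) yx.
Qed.

Lemma ord_le_bigU S x : (forall x, x ∈ S -> is_ordinal x) -> x ∈ S ->
  ord_le x (bigU S).
Proof.
move=> oS xS; apply: ord_sub_le; [exact: oS | exact: ord_bigU |].
by move=> z zx; apply/in_bigU; exists x.
Qed.

Lemma cup_max α β : is_ordinal α -> is_ordinal β ->
  cup α β = α \/ cup α β = β.
Proof.
move=> oα oβ; have [le|lt] := ord_leVlt oα oβ; [right|left];
  apply: set_ext => z; rewrite in_cup; split; auto; case=> // zz.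
  exact: ord_le_sub le _ zz.
exact: ord_trans lt.
Qed.

Lemma ord_cup α β : is_ordinal α -> is_ordinal β -> is_ordinal (cup α β).
Proof. by move=> oα oβ; case: (cup_max oα oβ) => ->. Qed.

Lemma cup_lub α β γ : is_ordinal γ -> α ∈ γ -> β ∈ γ -> cup α β ∈ γ.
Proof.
by move=> oγ αγ βγ; case: (@cup_max α β) => [||->|->] //; apply: ord_elt oγ _.
Qed.

Lemma le_cupl α β : is_ordinal α -> is_ordinal β -> ord_le α (cup α β).
Proof.
by move=> oα oβ; apply: ord_sub_le => //; [apply: ord_cup | move=> z; rewrite in_cup; left].
Qed.

Lemma le_cupr α β : is_ordinal α -> is_ordinal β -> ord_le β (cup α β).
Proof.
by move=> oα oβ; apply: ord_sub_le => //; [apply: ord_cup | move=> z; rewrite in_cup; right].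
Qed.

Lemma leastP (P : V -> Prop) : def1 P -> (exists α, is_ordinal α /\ P α) ->
  least_ordinal P (least P).
Proof.
move=> dP [α [oα Pα]].
apply: iotaP => [|y z [oy Py my] [oz Pz mz]]; last first.
  by apply: ord_le_anti; [apply: my | apply: mz].
pose s := sep (suc α) P.
have [|a [/(in_sep _ dP) [aα Pa] mina]] := @foundation s.
  by exists α; apply/in_sep => //; split=> //; apply: mem_suc.
have oa := ord_elt (ord_suc oα) aα.
exists a; split=> // β oβ Pβ; apply: ord_notin_le => // βa.
apply: (mina β βa); apply/in_sep => //; split=> //.
exact: ord_trans (ord_suc oα) βa aα.
Qed.

Lemma ord_ind (P : V -> Prop) : def1 P ->
  (forall α, is_ordinal α -> (forall β, β ∈ α -> P β) -> P α) ->
  forall α, is_ordinal α -> P α.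
Proof.
move=> dP IH α oα; apply: NNPP => nP.
have [||om nPm mm] := @leastP (fun α => ~ P α); [by definable | by exists α |].
apply: nPm; apply: IH => // β βm; apply: NNPP => nPβ.
by apply: (@ord_le_notin _ _ (mm β (ord_elt om βm) nPβ)).
Qed.

End Ordinals.

(** * Recursion along a well-founded relation on a set *)

Section Recursion.
Implicit Types (x y z a b s A α β γ τ : V).

Definition below A (R : V -> V -> Prop) x := sep A (fun y => R y x).

Definition well_founded_on A (R : V -> V -> Prop) := forall s,
  Defs.subset s A -> nonempty s -> exists x, x ∈ s /\ forall y, y ∈ s -> ~ R y x.

Definition transitive_on A (R : V -> V -> Prop) := forall x y z,
  x ∈ A -> y ∈ A -> z ∈ A -> R x y -> R y z -> R x z.

(** Call [g] an approximation at [x] if it satisfies the recursion equation up to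
    [x]. Two approximations agree where both are correct, by a minimal point of
    disagreement, so [F], the common value of all approximations, is definable. A
    minimal point without approximation cannot exist, because applying [G] once
    to the values of [F] gives one there. Feeding [G] only with the set of
    earlier values suffices for the collapse of a well-order and for iterating
    the Hartogs number. *)
Lemma wf_recursion A (R : V -> V -> Prop) (G : V -> V) :
  def2 R -> fdef1 G -> transitive_on A R -> well_founded_on A R ->
  exists f, fdef1 f /\ forall x, x ∈ A -> f x = G (img (below A R x) f).
Proof.
move=> dR dG tR wR.
have dRx x : def1 (fun y => R y x) by definable.
have in_below x y : y ∈ below A R x <-> y ∈ A /\ R y x by apply: in_sep.
have dap g : fdef1 (ap g) by definable.
pose upto y x := y ∈ A /\ (R y x \/ y = x).
pose approx x g := forall y, upto y x -> ap g y = G (img (below A R y) (ap g)).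
have upto_trans z y x : x ∈ A -> z ∈ below A R y -> upto y x -> upto z x.
  move=> xA /in_below [zA zy] [yA [yx|<-]]; split; auto.
  by left; apply: tR yx.
have uniq x x' g g' : x ∈ A -> x' ∈ A -> approx x g -> approx x' g' ->
    forall y, upto y x -> upto y x' -> ap g y = ap g' y.
  move=> xA x'A Hg Hg'; pose Q y := [/\ upto y x, upto y x' & ap g y <> ap g' y].
  have dQ : def1 Q by rewrite /Q /upto; definable.
  move=> y yx yx'; apply: NNPP => ne.
  have [||z [/(in_sep _ dQ) [zA [zx zx' nez]] minz]] := wR (sep A Q).
  - by move=> z /(in_sep _ dQ) [].
  - by exists y; apply/in_sep => //; split=> //; case: yx.
  apply: nez; rewrite Hg // Hg' //; congr G; apply: eq_img => // w wz.
  apply: NNPP => new; have [wA wz'] := proj1 (in_below _ _) wz.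
  apply: (minz w) => //; apply/in_sep => //; split=> //; split=> //.
    exact: upto_trans zx.
  exact: upto_trans zx'.
pose F y := iota (fun v => exists g, approx y g /\ v = ap g y).
have dF : fdef1 F by rewrite /F /approx /upto /below; definable.
have FE x g : x ∈ A -> approx x g -> F x = ap g x.
  move=> xA Hg; apply: iotaE => [|z [g' [Hg' ->]]]; first by exists g.
  by apply: (uniq x x) => //; split; auto.
have Fsub x g y : x ∈ A -> approx x g -> upto y x -> F y = ap g y.
  move=> xA Hg yx; apply: FE; first by case: yx.
  move=> z [zA zy]; apply: Hg; case: zy => [zy|->] //.
  by apply: upto_trans yx => //; apply/in_below.
pose f y := G (img (below A R y) F).
have df : fdef1 f by rewrite /f /below; definable.
have fF x g : x ∈ A -> approx x g -> F x = f x.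
  move=> xA Hg; rewrite (FE _ _ xA Hg) Hg; last by split; auto.
  congr G; apply: eq_img => // y yx; rewrite (Fsub x g) //.
  by apply: upto_trans yx _ => //; split; auto.
pose Q x := ~ exists g, approx x g.
have dQ : def1 Q by rewrite /Q /approx /upto /below; definable.
suff nQ x : x ∈ A -> ~ Q x.
  exists F; split=> // x xA; have [g Hg] := NNPP _ (nQ x xA).
  exact: fF Hg.
move=> xA Qx.
have [||z [/(in_sep _ dQ) [zA Qz] minz]] := wR (sep A Q).
- by move=> z /(in_sep _ dQ) [].
- by exists x; apply/in_sep.
apply: Qz; exists (lam A f) => y [yA yz]; rewrite ap_lam // /f.
congr G; apply: eq_img => // w wy; have [wA wy'] := proj1 (in_below _ _) wy.
rewrite ap_lam //; have wz : R w z by case: yz => [yz|<-] //; apply: tR yz.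
have [g Hg] : exists g, approx w g.
  by apply: NNPP => Qw; apply: (minz w) => //; apply/in_sep.
exact: fF Hg.
Qed.

(** * Order types *)

Definition total_on A (R : V -> V -> Prop) := forall x y,
  x ∈ A -> y ∈ A -> [\/ R x y, x = y | R y x].

Definition well_order A R :=
  [/\ transitive_on A R, total_on A R & well_founded_on A R].

Lemma well_order_total A R : well_order A R -> total_on A R.
Proof. by case. Qed.

(** Mostowski collapse: [f] sends [x] to the set of values at the predecessors of
    [x], so its range is transitive, and totality of [R] makes it injective. *)
Lemma order_type A (R : V -> V -> Prop) : def2 R -> well_order A R ->
  exists τ f, [/\ is_ordinal τ, fdef1 f, maps f A τ, onto f A τ
    & forall x y, x ∈ A -> y ∈ A -> R x y <-> f x ∈ f y].
Proof.
move=> dR [tR lR wR].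
have did : fdef1 (@id V) by definable.
have [f [df fE]] := wf_recursion dR did tR wR.
have in_f x z : x ∈ A -> z ∈ f x <-> exists y, [/\ y ∈ A, R y x & z = f y].
  move=> xA; rewrite fE // in_img //.
  have dRx : def1 (fun y => R y x) by definable.
  by split=> [[y [/(in_sep _ dRx) [? ?] ->]]|[y [yA yx ->]]]; exists y => //;
    split=> //; apply/in_sep.
have fR x y : x ∈ A -> y ∈ A -> R x y -> f x ∈ f y.
  by move=> xA yA xy; apply/in_f => //; exists x.
have Rf x y : x ∈ A -> y ∈ A -> f x ∈ f y -> R x y.
  move=> xA yA fxy; case: (lR x y xA yA) => // [E|/(fR _ _ yA xA)].
    by case: (@mem_irrefl (f y)); rewrite -{1}E.
  by move/(mem_asym fxy).
exists (img A f), f; split=> //.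
- split; first by move=> _ /in_img-/(_ df) [x [xA ->]] z /in_f-/(_ xA) [y [yA _ ->]];
    apply/in_img => //; exists y.
  split=> [y _|a b d|s ss ns]; first exact: mem_irrefl.
    rewrite !in_img // => -[x [xA ->]] [y [yA ->]] [z [zA ->]] xy yz.
    by apply: fR => //; apply: tR (Rf _ _ xA yA xy) (Rf _ _ yA zA yz).
  have dP : def1 (fun x => f x ∈ s) by definable.
  have [||x [/(in_sep _ dP) [xA fxs] minx]] := wR (sep A (fun x => f x ∈ s)).
  - by move=> z /(in_sep _ dP) [].
  - case: ns => z zs; have /in_img-/(_ df) [x [xA E]] := ss z zs.
    by exists x; apply/in_sep => //; rewrite -E.
  exists (f x); split=> // b bs; have /in_img-/(_ df) [y [yA E]] := ss b bs.
  rewrite E in bs *; case: (lR x y xA yA) => [xy|->|yx]; [|by left|].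
    by right; apply: fR.
  by case: (minx y) => //; apply/in_sep.
- by move=> x xA; apply/in_img => //; exists x.
- by move=> y /in_img-/(_ df) [x [xA ->]]; exists x.
- by move=> x y xA yA; split; [apply: fR | apply: Rf].
Qed.

Lemma order_iso_inj A f (R : V -> V -> Prop) : total_on A R ->
  (forall x y, x ∈ A -> y ∈ A -> R x y <-> f x ∈ f y) -> inj_on f A.
Proof.
move=> lR fR x y xA yA E.
have [/fR H|//|/fR H] := lR x y xA yA; have := H _ _; rewrite E.
  by move=> /(_ xA yA) /mem_irrefl.
by move=> /(_ yA xA) /mem_irrefl.
Qed.

(** At a least [x] with [F x] below [x], the map [F] would also lower [F x]. *)
Lemma increasing_ge α β (F : V -> V) : fdef1 F ->
  is_ordinal α -> is_ordinal β -> maps F α β ->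
  (forall x y, x ∈ α -> y ∈ α -> x ∈ y -> F x ∈ F y) ->
  forall x, x ∈ α -> ord_le x (F x).
Proof.
move=> dF oα oβ mF iF x xα.
have dP : def1 (fun x => x ∈ α -> ord_le x (F x)) by definable.
apply: (ord_ind dP _ (ord_elt oα xα)) xα => y oy IH yα.
have oFy := ord_elt oβ (mF y yα).
apply: ord_notin_le => // Fyy.
have Fyα := ord_trans oα Fyy yα.
by apply: (ord_le_notin (IH _ Fyy Fyα)); apply: iF.
Qed.

Lemma increasing_le α β (F : V -> V) : fdef1 F ->
  is_ordinal α -> is_ordinal β -> maps F α β ->
  (forall x y, x ∈ α -> y ∈ α -> x ∈ y -> F x ∈ F y) -> ord_le α β.
Proof.
move=> dF oα oβ mF iF; apply: ord_notin_le => // βα.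
exact: (ord_le_notin (increasing_ge dF oα oβ mF iF βα)) (mF _ βα).
Qed.

(** The order type [τ] is at most [α] because the inverse of the collapse is an
    increasing map from [τ] to [α]. *)
Lemma card_eq_sub_ord α A : is_ordinal α -> Defs.subset A α ->
  exists τ, [/\ is_ordinal τ, ord_le τ α & card_eq τ A].
Proof.
move=> oα Aα; have oA x : x ∈ A -> is_ordinal x by move/Aα; apply: ord_elt.
have lA : total_on A (@elt V).
  by move=> x y /oA ox /oA oy; apply: ord_trichotomy.
have [|τ [f [oτ df mf of_ fR]]] := order_type def_elt (A := A).
  split=> //; first by move=> x y z _ _ /oA oz; apply: ord_trans.
  by move=> s sA /foundation [x [xs xm]]; exists x; split=> // y ys /xm.
have if_ := order_iso_inj lA fR.
have K y := inv_onP (y:=y) if_ of_.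
exists τ; split=> //; last by apply: card_eq_sym; apply: (card_eqI df).
apply: (increasing_le (fdef_inv_on A df)) => // [x /K [/Aα]//|x y /K [xA Ex] /K [yA Ey]].
by rewrite -{1}Ex -{1}Ey -fR.
Qed.

Lemma card_eq_le_ord α A : is_ordinal α -> card_le A α ->
  exists τ, [/\ is_ordinal τ, ord_le τ α & card_eq τ A].
Proof.
move=> oα /card_leE [F [dF mF iF]].
have [|τ [oτ τα eτ]] := @card_eq_sub_ord α (img A F) oα.
  by move=> z /in_img-/(_ dF) [x [xA ->]]; apply: mF.
exists τ; split=> //; apply: card_eq_trans eτ (card_eq_sym _).
apply: (card_eqI dF) => // [x xA|y /in_img-/(_ dF) [x [xA ->]]].
  by apply/in_img => //; exists x.
by exists x.
Qed.

End Recursion.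

(** * Hartogs numbers and cardinals *)

Section Cardinals.
Implicit Types (x y z a b m n p q r s A B X α β γ κ μ τ η ξ : V).

Lemma condT (P : Prop) a b : P -> cond P a b = a.
Proof. by move=> HP; apply: iotaE => [|z [] []] //; left. Qed.

Lemma condF (P : Prop) a b : ~ P -> cond P a b = b.
Proof. by move=> HP; apply: iotaE => [|z [] []] //; right. Qed.

(** The order that an injection of [α] into [X] induces on its range, made
    reflexive because the strict order on a single point is empty and would not
    distinguish the ordinals 0 and 1. *)
Definition order_code X r α := is_ordinal α /\ exists f, is_injection f α X /\
  forall p, p ∈ r <-> exists β γ,
    [/\ β ∈ α, γ ∈ α & ord_le β γ /\ p = opair (ap f β) (ap f γ)].

(** Matching the points that have the same image in [X] is increasing. *)
Lemma order_code_le X r α β : order_code X r α -> order_code X r β -> ord_le α β.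
Proof.
move=> [oα [f [If rf]]] [oβ [g [Ig rg]]].
have iF := ap_inj_on If; have iG := ap_inj_on Ig.
pose F x := inv_on β (ap g) (ap f x).
have dF : fdef1 F by rewrite /F /inv_on; definable.
have le_code x y : x ∈ α -> y ∈ α -> ord_le x y -> exists x' y',
   [/\ x' ∈ β, y' ∈ β, ord_le x' y' & F x = x' /\ F y = y'].
  move=> xα yα xy; have : opair (ap f x) (ap f y) ∈ r.
    by apply/rf; exists x, y.
  move/rg=> [x' [y' [xβ yβ [le /opair_inj [Ex Ey]]]]].
  by exists x', y'; split=> //; rewrite /F Ex Ey !inv_onK.
apply: (increasing_le dF) => // [x xα|x y xα yα xy].
  by have [x' [_ [? _ _ [-> _]]]] := le_code x x xα xα (ord_le_refl x).
have [x' [y' [xβ yβ le [Ex Ey]]]] := le_code x y xα yα (or_introl xy).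
rewrite Ex Ey; case: le => // E.
case: (@mem_irrefl x); rewrite {2}(_ : x = y) //; apply: iF => //.
have K z : z ∈ α -> ap g (F z) = ap f z.
  move=> zα; have : opair (ap f z) (ap f z) ∈ r.
    by apply/rf; exists z, z; split=> //; split=> //; right.
  by move/rg=> [w [_ [wβ _ [_ /opair_inj [Ez _]]]]]; rewrite /F Ez inv_onK.
by rewrite -(K _ xα) -(K _ yα) Ex Ey E.
Qed.

(** Otherwise every ordinal has a code among the relations on [X]; as a code
    determines its ordinal, replacement collects all ordinals into a set. *)
Lemma hartogs_bound X : exists α, is_ordinal α /\ ~ card_le α X.
Proof.
apply: NNPP => n.
have {n} inj α : is_ordinal α -> card_le α X.
  by move=> oα; apply: NNPP => nle; apply: n; exists α.
pose T r := iota (order_code X r).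
have dT : fdef1 T by rewrite /T /order_code; definable.
have TE r α : order_code X r α -> T r = α.
  move=> c; apply: iotaE => // β c'.
  by apply: ord_le_anti; apply: order_code_le; eauto.
pose S := sep (img (pow (cross X X)) T) (@is_ordinal V).
have inS α : α ∈ S <-> α ∈ img (pow (cross X X)) T /\ is_ordinal α.
  by apply: in_sep; definable.
have allS α : is_ordinal α -> α ∈ S.
  move=> oα; apply/inS; split=> //; apply/in_img => //.
  have [f If] := inj α oα; have mf := ap_from_to (proj1 If).
  pose P p := exists β γ,
    [/\ β ∈ α, γ ∈ α & ord_le β γ /\ p = opair (ap f β) (ap f γ)].
  have dP : def1 P by rewrite /P; definable.
  exists (sep (cross X X) P); split.
    by apply/in_pow => z /(in_sep _ dP) [].
  rewrite (@TE _ α) //; split=> //; exists f; split=> // p.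
  rewrite (in_sep _ dP); split=> [[]//|Pp]; split=> //.
  by case: Pp => [β [γ [βα γα [_ ->]]]]; apply/opair_cross; split; apply: mf.
have oS x : x ∈ S -> is_ordinal x by move/inS => [].
have := ord_le_bigU oS (allS _ (ord_suc (ord_bigU oS))).
by move/ord_le_notin; apply; apply: mem_suc.
Qed.

Definition hartogs X := least (fun α => ~ card_le α X).

Lemma fdef_hartogs : fdef1 hartogs.
Proof. by rewrite /hartogs; definable. Qed.

Lemma hartogsP X : is_Hartogs X (hartogs X).
Proof. by apply: leastP; [definable | apply: hartogs_bound]. Qed.

Lemma Hartogs_card_le X η α : is_Hartogs X η -> α ∈ η -> card_le α X.
Proof.
move=> [oη _ mη] αη; apply: NNPP => nle.
exact: ord_le_notin (mη _ (ord_elt oη αη) nle) αη.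
Qed.

Lemma lt_hartogs X α : is_ordinal α -> card_le α X -> α ∈ hartogs X.
Proof.
move=> oα le; have [oh nh _] := hartogsP X.
case: (ord_leVlt oh oα) => // hα; case: nh.
by apply: card_le_trans le; apply/card_le_subset/ord_le_sub.
Qed.

(** A surjection of [X] onto [α] makes [α] inject into the power set of [X]. *)
Lemma Lindenbaum_exists X : exists ν, is_Lindenbaum X ν.
Proof.
exists (least (fun α => ~ card_le_star α X)); apply: leastP; first by definable.
have [oh nh _] := hartogsP (pow X); exists (hartogs (pow X)); split=> // le.
apply: nh; set η := hartogs _ in oh le *.
have [[y yη]|ne] := classic (nonempty η); last first.
  by apply: card_le_subset => z zη; case: ne; exists z.
have [f [df mf of_]] := card_le_starE yη le.
have inF α x : x ∈ sep X (fun x => f x = α) <-> x ∈ X /\ f x = α.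
  by apply: in_sep; definable.
apply: (@card_leI _ _ (fun α => sep X (fun x => f x = α))); first by definable.
  by move=> α _; apply/in_pow => x /inF [].
move=> α β /of_ [x [xX Ex]] _ E; have := proj2 (inF α x) (conj xX Ex).
by rewrite E => /inF [_ <-].
Qed.

Lemma Lindenbaum_gt X ν μ : is_Lindenbaum X ν -> is_ordinal μ ->
  card_le_star μ X -> μ ∈ ν.
Proof.
move=> [oν nν _] oμ le; case: (ord_leVlt oν oμ) => // νμ; case: nν.
have [[y yν]|ne] := classic (nonempty ν); last first.
  by right=> z zν; apply: ne; exists z.
have νsub := ord_le_sub oμ νμ.
have [f [df mf of_]] := card_le_starE (νsub y yν) le.
pose g x := cond (f x ∈ ν) (f x) y.
have dg : fdef1 g by rewrite /g; definable.
apply: (card_le_starI dg) => [x xX|z zν].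
  by have [?|?] := classic (f x ∈ ν); [rewrite /g condT | rewrite /g condF].
by have [x [xX Ex]] := of_ z (νsub z zν); exists x; rewrite /g condT Ex.
Qed.

Lemma cardinalI κ : is_ordinal κ -> (forall α, α ∈ κ -> ~ card_le κ α) ->
  is_cardinal κ.
Proof. by move=> oκ H; split=> // α /H n /card_eq_ge. Qed.

(** The range of an injection into [α] has an order type at most [α], which is
    then an ordinal below [κ] in bijection with [κ]. *)
Lemma cardinal_not_le κ α : is_cardinal κ -> α ∈ κ -> ~ card_le κ α.
Proof.
move=> [oκ H] ακ /(card_eq_le_ord (ord_elt oκ ακ)) [τ [oτ τα e]].
by apply: (H τ) => //; apply: ord_le_lt_trans τα _.
Qed.

Lemma Hartogs_cardinal X η : is_Hartogs X η -> is_cardinal η.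
Proof.
move=> H; have [oη nη _] := H; apply: cardinalI => // α αη le.
by apply: nη; apply: card_le_trans le _; apply: Hartogs_card_le H αη.
Qed.

Lemma card_eq_refl A : card_eq A A.
Proof.
apply: (@card_eqI A A id) => //; first by definable.
by move=> x xA; exists x.
Qed.

Lemma cardinality α : is_ordinal α ->
  exists κ, [/\ is_cardinal κ, ord_le κ α & card_eq κ α].
Proof.
move=> oα; have [||oκ e mκ] := @leastP (fun κ => card_eq κ α).
- by definable.
- by exists α; split=> //; apply: card_eq_refl.
exists (least (fun κ => card_eq κ α)); split=> //.
  split=> // β βκ eβ.
  have := mκ β (ord_elt oκ βκ) (card_eq_trans eβ e).
  by move/ord_le_notin; apply.
by apply: mκ => //; apply: card_eq_refl.
Qed.

(** * Finite ordinals *)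

Lemma natural_le n m : is_natural n -> ord_le m n -> is_natural m.
Proof.
move=> [on H] mn; split; first by case: mn => [/(ord_elt on)|->].
by move=> x xm; apply: H; apply: ord_le_trans mn.
Qed.

Lemma natural_suc n : is_natural n -> is_natural (suc n).
Proof.
move=> [on H]; split; first exact: ord_suc.
move=> x [/in_suc x_n|->]; first by apply: H.
by right; exists n; apply/is_succ_suc.
Qed.

Lemma natural_empty n : is_empty n -> is_natural n.
Proof.
move=> en; split; last by move=> x [/en|->] //; left.
by apply: ord_of_ordinals => x /en.
Qed.

Lemma finite_ord α n : is_ordinal α -> is_natural n -> card_le α n -> is_finite α.
Proof.
move=> oα nn /(card_eq_le_ord (proj1 nn)) [τ [oτ τn e]].
by exists τ; split=> //; apply: natural_le τn.
Qed.

Lemma natural_finite n : is_natural n -> is_finite n.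
Proof. by move=> nn; exists n; split=> //; apply: card_eq_refl. Qed.

Lemma infinite_nonempty κ : infinite_cardinal κ -> nonempty κ.
Proof.
move=> [_ nf]; apply: NNPP => ne; apply/nf/natural_finite/natural_empty.
by move=> x xκ; apply: ne; exists x.
Qed.

Lemma suc_inj x y : suc x = suc y -> x = y.
Proof.
move=> E; have := mem_suc x; rewrite E => /in_suc [xy|//].
by have := mem_suc y; rewrite -E => /in_suc [/(mem_asym xy)|].
Qed.

(** A limit ordinal [x] below [β] absorbs one more point: shifting [x] by one
    frees its first element for [β]. *)
Lemma card_le_suc β : is_ordinal β -> ~ is_natural β -> card_le (suc β) β.
Proof.
move=> oβ nβ.
have [x [xβ [nx lx]]] : exists x, ord_le x β /\ (nonempty x /\ forall y, x <> suc y).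
  apply: NNPP => nex; apply: nβ; split=> // x xβ.
  apply: NNPP => nx; apply: nex; exists x; split=> //; split.
    by apply: NNPP => ne; apply: nx; left=> y yx; apply: ne; exists y.
  by move=> y E; apply: nx; right; exists y; apply/is_succ_suc.
have ox : is_ordinal x by case: xβ => [/(ord_elt oβ)|->].
have sx y : y ∈ x -> suc y ∈ x.
  by move=> /(suc_le ox) [//|E]; case: (lx y).
have [z ez] := empty_exists.
have zx : z ∈ x.
  have [||//|E] := @ord_initial x z ox; try by move=> y /ez.
  by case: nx => y; rewrite -E => /ez.
pose F ξ := cond (ξ = β) z (cond (ξ ∈ x) (suc ξ) ξ).
have dF : fdef1 F by rewrite /F; definable.
have xsub := ord_le_sub oβ xβ.
have βx : ~ β ∈ x by apply: ord_le_notin.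
have cases ξ : ξ ∈ suc β ->
    [\/ ξ = β /\ F ξ = z, ξ ∈ x /\ F ξ = suc ξ | [/\ ξ ∈ β, ~ ξ ∈ x & F ξ = ξ]].
  rewrite /F => /in_suc [ξβ|->]; last by constructor 1; rewrite condT.
  have ne : ξ <> β by move=> E; apply: (@mem_irrefl β); rewrite -{1}E.
  rewrite condF //; have [ξx|ξx] := classic (ξ ∈ x).
    by constructor 2; rewrite condT.
  by constructor 3; rewrite condF.
apply: (card_leI dF) => [ξ /cases [] [] //|ξ ξ' /cases c /cases c'].
- by move=> _ ->; apply: xsub.
- by move=> ξx ->; apply/xsub/sx.
- by move=> ? _ ->.
case: c c' => [[-> ->]|[ξx ->]|[ξβ ξx ->]] [[-> ->]|[ξx' ->]|[ξβ' ξx' ->]] // E.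
- by case: (ez ξ'); rewrite E; apply: mem_suc.
- by case: ξx'; rewrite -E.
- by case: (ez ξ); rewrite -E; apply: mem_suc.
- exact: suc_inj.
- by case: ξx'; rewrite -E; apply: sx.
- by case: ξx; rewrite E.
- by case: ξx; rewrite E; apply: sx.
Qed.

Lemma infinite_limit κ β : infinite_cardinal κ -> β ∈ κ -> suc β ∈ κ.
Proof.
move=> [cκ nf] βκ; have [oκ _] := cκ; have oβ := ord_elt oκ βκ.
case: (suc_le oκ βκ) => // E; case: (cardinal_not_le cκ βκ).
rewrite -E; apply: card_le_suc => // /natural_suc; rewrite E.
by move/natural_finite.
Qed.

Lemma limit_infinite μ : is_cardinal μ -> nonempty μ ->
  (forall β, β ∈ μ -> suc β ∈ μ) -> infinite_cardinal μ.
Proof.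
move=> cμ nμ lμ; split=> // -[n [nn /card_eq_ge le]].
have [oμ _] := cμ; have [on _] := nn.
have μn : ord_le μ n by apply: ord_notin_le => // /(cardinal_not_le cμ).
case: (natural_le nn μn) => _ /(_ μ (ord_le_refl μ)) [eμ|[y /is_succ_suc E]].
  by case: nμ => y /eμ.
by apply: (@mem_irrefl μ); rewrite {1}E; apply: lμ; rewrite E; apply: mem_suc.
Qed.

(** The least strict upper bound of a nonempty set of elements of [n] is a
    successor, hence the successor of a largest element. *)
Lemma natural_max n : is_natural n -> well_founded_on n (fun x y => y ∈ x).
Proof.
move=> nn s sn ns; have [on _] := nn.
have dP : def1 (fun β => forall y, y ∈ s -> y ∈ β) by definable.
have [|oβ bβ mβ] := leastP dP; first by exists n; split=> // y /sn.
set β := least _ in oβ bβ mβ.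
have βn : ord_le β n by apply: mβ => // y /sn.
case: (natural_le nn βn) => _ /(_ β (ord_le_refl β)) [eβ|[γ /is_succ_suc E]].
  by case: ns => y /bβ /eβ.
have γβ : γ ∈ β by rewrite E; apply: mem_suc.
exists γ; split.
  apply: NNPP => γs.
  suff /(mβ γ (ord_elt oβ γβ))/ord_le_notin : forall y, y ∈ s -> y ∈ γ by apply.
  move=> y ys; have := bβ y ys; rewrite E => /in_suc [//|Ey].
  by case: γs; rewrite -Ey.
by move=> y /bβ; rewrite E => /in_suc [yγ|->]; [apply: mem_asym | apply: mem_irrefl].
Qed.

End Cardinals.
#[local] Hint Resolve fdef_hartogs : definable.

(** * Products of well-ordered cardinals *)

Section Products.
Implicit Types (x y z a b m n p q r s A B X α β γ κ μ τ η ξ : V).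

(** The order [E] is left open because Gödel's order is used both with membership
    and, on natural numbers, with its converse. *)
Definition lex (E : V -> V -> Prop) (f : V -> V) (R : V -> V -> Prop) p q :=
  E (f p) (f q) \/ f p = f q /\ R p q.

Lemma transitive_lex A B E f R : maps f A B -> transitive_on B E ->
  transitive_on A R -> transitive_on A (lex E f R).
Proof.
move=> mf tE tR p q r pA qA rA [pq|[epq pq]] [qr|[eqr qr]].
- by left; apply: tE pq qr; apply: mf.
- by left; rewrite -eqr.
- by left; rewrite epq.
- by right; rewrite epq; split=> //; apply: tR pq qr.
Qed.

Lemma well_founded_lex A B E f R : fdef1 f -> maps f A B -> well_founded_on B E ->
  well_founded_on A R -> well_founded_on A (lex E f R).
Proof.
move=> df mf wE wR s sA ns.
have [||w [/in_img-/(_ df) [x [xs ->]] minx]] := wE (img s f).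
- by move=> z /in_img-/(_ df) [x [/sA xA ->]]; apply: mf.
- by case: ns => x xs; exists (f x); apply/in_img => //; exists x.
have dP : def1 (fun z => f z = f x) by definable.
have [||z [/(in_sep _ dP) [zs Ez] minz]] := wR (sep s (fun z => f z = f x)).
- by move=> z /(in_sep _ dP) [/sA].
- by exists x; apply/in_sep.
exists z; split=> // y ys; rewrite /lex Ez => -[|[Ey]].
  by apply: minx; apply/in_img => //; exists y.
by apply: minz; apply/in_sep.
Qed.

Lemma well_founded_elt A : well_founded_on A (@elt V).
Proof.
by move=> s _ /foundation [x [xs minx]]; exists x; split=> // y ys /minx.
Qed.

(** Gödel's order on pairs of ordinals (for [E] the membership relation):
    compare the maxima, then the first components, then the second ones. *)
Definition pmax p := cup (pr1 p) (pr2 p).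
Definition godel (E : V -> V -> Prop) :=
  lex E pmax (lex E pr1 (lex E pr2 (fun _ _ => False))).

Lemma fdef_pmax : fdef1 pmax.
Proof. by rewrite /pmax; definable. Qed.

Lemma cross_maps α : is_ordinal α -> [/\ maps pmax (cross α α) α,
  maps pr1 (cross α α) α & maps pr2 (cross α α) α].
Proof.
move=> oα; split=> _ /in_cross [a [b [aα bα ->]]]; rewrite ?/pmax ?pr1E ?pr2E //.
exact: cup_lub.
Qed.

Lemma well_founded_godel α E : is_ordinal α -> well_founded_on α E ->
  well_founded_on (cross α α) (godel E).
Proof.
move=> oα wE; have [m0 m1 m2] := cross_maps oα.
apply: (well_founded_lex fdef_pmax m0 wE).
apply: (well_founded_lex fdef_pr1 m1 wE).
apply: (well_founded_lex fdef_pr2 m2 wE).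
by move=> s _ [x xs]; exists x; split=> // y _ [].
Qed.

Lemma well_order_godel α : is_ordinal α ->
  well_order (cross α α) (godel (@elt V)).
Proof.
move=> oα; have [m0 m1 m2] := cross_maps oα.
have tE : transitive_on α (@elt V).
  by move=> x y z _ _ zα; apply/ord_trans/(ord_elt oα).
split; last exact/well_founded_godel/well_founded_elt.
  apply: (transitive_lex m0 tE); apply: (transitive_lex m1 tE).
  by apply: (transitive_lex m2 tE).
move=> p q pA qA.
have tri (f : V -> V) : maps f (cross α α) α -> [\/ f p ∈ f q, f p = f q | f q ∈ f p].
  by move=> mf; apply: ord_trichotomy; apply: (ord_elt oα); apply: mf.
have [l0|e0|l0] := tri _ m0; [by constructor 1; left| |by constructor 3; left].
have [l1|e1|l1] := tri _ m1;
  [by constructor 1; right; split=> //; left| |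
   by constructor 3; right; split=> //; left].
have [l2|e2|l2] := tri _ m2;
  [by constructor 1; right; split=> //; right; split=> //; left| |
   by constructor 3; right; split=> //; right; split=> //; left].
constructor 2; move: pA qA e1 e2 => /in_cross [a [b [_ _ ->]]].
by move=> /in_cross [c [d [_ _ ->]]]; rewrite !pr1E !pr2E => -> ->.
Qed.

Lemma def_godel : def2 (godel (@elt V)).
Proof. by rewrite /godel /lex /pmax; definable. Qed.

(** The Gödel order on the square of a natural number has no infinite ascending
    chain either, so every nonempty initial segment of its order type has a last
    element. *)
Lemma natural_square n : is_natural n ->
  exists k, is_natural k /\ card_le (cross n n) k.
Proof.
move=> nn; have [on _] := nn; have wo := well_order_godel on.
have [τ [f [oτ df mf of_ fR]]] := order_type def_godel wo.
have if_ := order_iso_inj (well_order_total wo) fR.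
exists τ; split; last exact: card_leI if_.
split=> // x xτ; have ox : is_ordinal x by case: xτ => [/(ord_elt oτ)|->].
have [[y yx]|ne] := classic (nonempty x); last first.
  by left=> y yx; apply: ne; exists y.
right; have dP : def1 (fun p => f p ∈ x) by definable.
have wf := well_founded_godel on (natural_max nn).
have [||p [/(in_sep _ dP) [pA fpx] maxp]] := wf (sep (cross n n) (fun p => f p ∈ x)).
- by move=> z /(in_sep _ dP) [].
- have [p [pA E]] := of_ y (ord_le_sub oτ xτ yx).
  by exists p; apply/in_sep => //; rewrite E.
have dual q r : godel (@elt V) q r -> godel (fun x y => y ∈ x) r q.
  case=> [?|[e0 [?|[e1 [?|[_ []]]]]]]; first by left.
    by right; split=> //; left.
  by right; split=> //; right; split=> //; left.
exists (f p); apply/is_succ_suc/set_ext => z; rewrite in_suc; split=> [zx|].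
  have [q [qA Eq]] := of_ z (ord_le_sub oτ xτ zx).
  rewrite -Eq in zx *; case: (well_order_total wo pA qA) => [/dual|->|].
  - by move=> /maxp H; case: H; apply/in_sep.
  - by right.
  - by move/(fR _ _ qA pA); left.
by case=> [zp|-> //]; apply: ord_trans zp fpx.
Qed.

(** The squaring hypothesis on [m] is conditional because this serves within the
    induction that proves it. If [m] is finite, then so is its square, and [μ]
    would be finite. *)
Lemma not_card_le_square μ m : infinite_cardinal μ -> m ∈ μ ->
  (~ is_finite m -> card_le (cross m m) m) -> ~ card_le μ (cross m m).
Proof.
move=> [cμ nf] mμ H le; have [fm|/H lm] := classic (is_finite m); last first.
  exact: cardinal_not_le cμ mμ (card_le_trans le lm).
have [n [nn /card_eq_ge mn]] := fm; have [k [nk lk]] := natural_square nn.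
apply/nf/(finite_ord (proj1 cμ) nk).
by apply: card_le_trans le _; apply: card_le_trans lk; apply: card_le_cross.
Qed.

(** By induction one may take [α] to be an infinite cardinal. If Gödel's order on
    its square were longer than [α], then [α] would inject into a proper initial
    segment, hence into the square of a smaller ordinal. *)
Lemma hessenberg α : is_ordinal α -> ~ is_finite α -> card_le (cross α α) α.
Proof.
have dP : def1 (fun α => ~ is_finite α -> card_le (cross α α) α) by definable.
apply: (ord_ind dP) => {}α oα IH nfα.
have [κ [cκ κα e]] := cardinality oα.
case: κα => [κα|E].
  have lκ : card_le (cross κ κ) κ.
    apply: IH => // -[n [nn en]]; apply: nfα.
    by exists n; split=> //; apply: card_eq_trans e.
  apply: card_le_trans (card_le_trans lκ (card_eq_le e)).
  by apply: card_le_cross; apply: card_eq_ge.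
rewrite {}E in cκ; have iα : infinite_cardinal α by [].
have wo := well_order_godel oα.
have [τ [f [oτ df mf of_ fR]]] := order_type def_godel wo.
have if_ := order_iso_inj (well_order_total wo) fR.
have K z := inv_onP (y:=z) if_ of_.
have [τα|ατ] := ord_leVlt oτ oα.
  by apply: (card_leI df) => // x /mf; apply: ord_le_sub.
(* The pairs before the [α]-th one have maximum at most that of [p]. *)
have [pA Ep] := K α ατ; set p := inv_on _ _ _ in pA Ep.
have [m0 _ _] := cross_maps oα; have mα := infinite_limit iα (m0 _ pA).
have omp := ord_elt oα (m0 _ pA).
case: (not_card_le_square iα mα (IH _ mα)).
have ατs z : z ∈ α -> z ∈ τ by move=> zα; apply: ord_trans ατ.
apply: (card_leI (fdef_inv_on (cross α α) df)) => [z zα|x y /ατs /K [_ {2}<-]].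
  have [qA Eq] := K z (ατs z zα); set q := inv_on _ _ _ in qA Eq *.
  have qp : ord_le (pmax q) (pmax p).
    have : f q ∈ f p by rewrite Eq Ep.
    by move/(fR _ _ qA pA) => -[|[-> _]]; [left|right].
  move: qA qp => /in_cross [a [b [aα bα ->]]]; rewrite {1}/pmax pr1E pr2E => le.
  have [oa ob] := (ord_elt oα aα, ord_elt oα bα).
  by apply/opair_cross; split; apply: (ord_le_lt_trans (ord_suc omp) _ (mem_suc _));
    apply: ord_le_trans le => //; [apply: le_cupl | apply: le_cupr].
by move=> /ατs /K [_ {2}<-] ->.
Qed.

Lemma cardinal_square_lt μ m : infinite_cardinal μ -> m ∈ μ ->
  ~ card_le μ (cross m m).
Proof.
move=> iμ mμ; apply: (not_card_le_square iμ mμ); apply: hessenberg.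
by case: iμ => -[oμ _] _; apply: ord_elt oμ mμ.
Qed.

End Products.

(** * Cofinality and extendable choice *)

Section Cofinality.
Implicit Types (x y z a b m n p q s A B X α β γ δ κ μ τ θ η ξ : V).
Implicit Types (k h F : V -> V).

Lemma infinite_ord κ : infinite_cardinal κ -> is_ordinal κ.
Proof. by case=> -[]. Qed.

Definition limit_ordinal α :=
  [/\ is_ordinal α, nonempty α & forall β, β ∈ α -> suc β ∈ α].

Lemma infinite_limit_ordinal κ : infinite_cardinal κ -> limit_ordinal κ.
Proof.
move=> iκ; split; [exact: infinite_ord | exact: infinite_nonempty |].
by move=> β; apply: infinite_limit.
Qed.

(** Nondecreasing cofinal maps. Equality of cofinalities is only ever used
    through such maps, which go directly from one ordinal to the other. *)
Definition climbs k μ κ :=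
  [/\ fdef1 k, maps k μ κ,
      forall β γ, β ∈ μ -> γ ∈ μ -> ord_le β γ -> ord_le (k β) (k γ)
    & forall γ, γ ∈ κ -> exists β, β ∈ μ /\ ord_le γ (k β)].

(** Below the cofinality, a map that is not cofinal misses a final segment. *)
Lemma cof_bounded α θ δ f : is_ordinal α -> is_cof α θ -> δ ∈ θ ->
  fdef1 f -> maps f δ α -> exists γ, γ ∈ α /\ forall ξ, ξ ∈ δ -> f ξ ∈ γ.
Proof.
move=> oα [oθ _ mθ] δθ df mf; apply: NNPP => n.
case: (ord_le_notin _ δθ); apply: mθ; first exact: ord_elt δθ.
apply/cofinal_mapP; exists f; split=> // γ γα; apply: NNPP => nδ; apply: n.
exists γ; split=> // ξ ξδ.
case: (ord_leVlt (ord_elt oα γα) (ord_elt oα (mf _ ξδ))) => // le.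
by case: nδ; exists ξ.
Qed.

(** Let [f] and [h] be cofinal maps from [θ] to [μ] and to [κ]. The indices up to
    the first one where [f] reaches [β] are bounded in [θ], so [h] is bounded on
    them; [k β] is the least bound. It increases with [β], and it is cofinal since
    for large [β] these indices include any given one. *)
Lemma cof_climbs κ μ θ : is_ordinal κ -> is_ordinal μ ->
  is_cof κ θ -> is_cof μ θ -> exists k, climbs k μ κ.
Proof.
move=> oκ oμ cκ cμ; have [oθ /cofinal_mapP [h [dh mh ch]] _] := cκ.
have [_ /cofinal_mapP [f [df mf cf]] _] := cμ.
(* That is, [δ] is at most the first index where [f] reaches [β]. *)
pose below_f δ β := δ ∈ θ /\ forall ξ, ξ ∈ δ -> f ξ ∈ β.
pose bound β γ := γ ∈ κ /\ forall δ, below_f δ β -> ord_le (h δ) γ.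
have db β : def1 (bound β) by rewrite /bound /below_f; definable.
pose k β := least (bound β).
have kP β : β ∈ μ -> least_ordinal (bound β) (k β).
  move=> βμ; apply: leastP => //.
  have oβ := ord_elt oμ βμ; have [δ0 [δ0θ le0]] := cf β βμ.
  have [γ [γκ bγ]] : exists γ, γ ∈ κ /\ forall ξ, ξ ∈ δ0 -> h ξ ∈ γ.
    by apply: (cof_bounded oκ cκ δ0θ dh) => ξ ξδ; apply: mh; apply: ord_trans δ0θ.
  have [oγ oh] := (ord_elt oκ γκ, ord_elt oκ (mh _ δ0θ)).
  exists (cup γ (h δ0)); split; first exact: ord_cup.
  split=> [|δ [δθ Hδ]]; first by apply: cup_lub => //; apply: mh.
  case: (ord_leVlt (ord_elt oθ δθ) (ord_elt oθ δ0θ)) => [[δδ0|->]|/Hδ /ord_le_notin].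
  - apply: ord_le_trans (le_cupl oγ oh); first exact: ord_cup.
    by left; apply: bγ.
  - exact: le_cupr.
  - by case.
exists k; split.
- by rewrite /k /bound /below_f; definable.
- by move=> β /kP [_ []].
- move=> β γ βμ γμ le; have [oβ [kβ _] mβ] := kP β βμ; have [oγ [kγ bγ] _] := kP γ γμ.
  apply: mβ => //; split=> // δ [δθ Hδ]; apply: bγ; split=> // ξ /Hδ fβ.
  by apply: ord_lt_le_trans fβ le; apply: ord_elt γμ.
- move=> γ /ch [δ [δθ le]].
  have [β [βμ Hβ]] : exists β, β ∈ μ /\ forall ξ, ξ ∈ δ -> f ξ ∈ β.
    by apply: (cof_bounded oμ cμ δθ df) => ξ ξδ; apply: mf; apply: ord_trans δθ.
  have [okβ [kκ bβ] _] := kP β βμ.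
  by exists β; split=> //; apply: ord_le_trans le _ => //; apply: bβ.
Qed.

Lemma class_climbs κ μ : is_ordinal κ -> in_cof_class κ μ ->
  (exists k, climbs k μ κ) /\ (exists k, climbs k κ μ).
Proof.
move=> oκ [[oμ _] [θ [cμ cκ]]].
by split; [apply: cof_climbs cκ cμ | apply: cof_climbs cμ cκ].
Qed.

(** If [β] were the largest element of [μ], then [k β] would be the largest
    element of [κ]. *)
Lemma climbs_limit κ μ k : limit_ordinal κ -> is_ordinal μ -> climbs k μ κ ->
  limit_ordinal μ.
Proof.
move=> [oκ [γ γκ] lκ] oμ [dk mk ik ck]; split=> //.
  by have [β [βμ _]] := ck γ γκ; exists β.
move=> β βμ; case: (suc_le oμ βμ) => // E.
have [ξ [ξμ]] := ck _ (lκ _ (mk _ βμ)).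
have le : ord_le ξ β by move: ξμ; rewrite -E => /in_suc.
have lek := ik _ _ ξμ βμ le.
move=> /ord_le_notin; case; apply: ord_le_lt_trans lek (mem_suc _).
by apply/ord_suc/(ord_elt oκ)/mk.
Qed.

Lemma class_infinite κ μ : infinite_cardinal κ -> in_cof_class κ μ ->
  infinite_cardinal μ.
Proof.
move=> iκ c; have oκ := infinite_ord iκ; have [[k ck] _] := class_climbs oκ c.
have [cμ _] := c; have lκ := infinite_limit_ordinal iκ.
have [_ nμ lμ] := climbs_limit lκ (proj1 cμ) ck.
exact: limit_infinite.
Qed.

Lemma is_cof_exists α : is_ordinal α -> exists θ, is_cof α θ.
Proof.
move=> oα; exists (least (fun γ => exists f, is_cofinal_map f γ α)).
apply: leastP; first by definable.
exists α; split=> //; apply/cofinal_mapP; exists id; split=> //; first by definable.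
by move=> γ γα; exists γ; split=> //; right.
Qed.

Lemma class_refl κ : is_cardinal κ -> in_cof_class κ κ.
Proof. by move=> cκ; split=> //; have [θ] := is_cof_exists (proj1 cκ); exists θ. Qed.

(** Only the values up to [β] are constrained: a selector for a longer segment
    belongs to all earlier sets of the family. *)
Definition selectors κ (F : V -> V) β :=
  sep (pow (cross κ (bigU (img κ F))))
    (fun s => forall γ, γ ∈ κ -> ord_le γ β -> ap s γ ∈ F γ).

Lemma in_selectors κ F β s : fdef1 F -> s ∈ selectors κ F β <->
  s ∈ pow (cross κ (bigU (img κ F))) /\
  forall γ, γ ∈ κ -> ord_le γ β -> ap s γ ∈ F γ.
Proof. by move=> dF; apply: in_sep; definable. Qed.

Lemma fdef_selectors κ F : fdef1 F -> fdef1 (selectors κ F).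
Proof. by move=> dF; rewrite /selectors; definable. Qed.

Lemma selectors_nonempty κ F β : limit_ordinal κ -> fdef1 F ->
  (forall β, β ∈ κ -> exists s : V -> V, fdef1 s /\
    forall γ, γ ∈ β -> s γ ∈ F γ) ->
  β ∈ κ -> nonempty (selectors κ F β).
Proof.
move=> [oκ _ lκ] dF aF βκ; have [s [ds sF]] := aF _ (lκ _ βκ).
exists (lam (suc β) s); apply/in_selectors => //; split.
  apply/in_pow => z /in_lam-/(_ ds) [γ [γβ ->]]; apply/opair_cross.
  have γκ := ord_trans oκ γβ (lκ _ βκ).
  split=> //; apply/in_bigU; exists (F γ); split; last exact: sF.
  by apply/in_img => //; exists γ.
move=> γ γκ le; have γβ : γ ∈ suc β by apply/in_suc.
by rewrite ap_lam //; apply: sF.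
Qed.

(** A selector for [F] is assembled from selectors of longer and longer initial
    segments, indexed along the climbing map. The family of these sets of
    selectors is approachable for a trivial reason: up to any stage, a single
    long enough selector belongs to all of them. *)
Lemma EC_climbs κ μ k : limit_ordinal κ -> is_ordinal μ -> climbs k μ κ ->
  EC μ -> EC κ.
Proof.
move=> lκ oμ [dk mk ik ck]; have [oκ _ _] := lκ.
rewrite !ECP; [|exact: (proj1 oκ)|exact: (proj1 oμ)] => H F dF nF aF.
have dS := fdef_selectors κ dF.
have ne β : β ∈ μ -> nonempty (selectors κ F (k β)).
  by move=> βμ; apply: selectors_nonempty => //; apply: mk.
have [||| s [ds sS]] := H (fun β => selectors κ F (k β)) => //.
- by definable.
- move=> β βμ; have [s /in_selectors-/(_ dF) [sp sF]] := ne β βμ.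
  exists (fun=> s); split=> [|γ γβ]; first by definable.
  apply/in_selectors => //; split=> // ξ ξκ le; apply: sF => //.
  have γμ := ord_trans oμ γβ βμ; apply: ord_le_trans le _; last by apply: ik; last left.
  exact/(ord_elt oκ)/mk.
pose t γ := least (fun β => β ∈ μ /\ ord_le γ (k β)).
have dt : fdef1 t by rewrite /t; definable.
exists (fun γ => ap (s (t γ)) γ); split=> [|γ γκ]; first by definable.
have [||_ [tμ le] _] := @leastP (fun β => β ∈ μ /\ ord_le γ (k β)).
- by definable.
- by have [β [βμ le]] := ck γ γκ; exists β; split=> //; apply: ord_elt βμ.
by have /in_selectors-/(_ dF) [_] := sS _ tμ; apply.
Qed.

Lemma EC_class κ μ : infinite_cardinal κ -> in_cof_class κ μ -> EC μ <-> EC κ.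
Proof.
move=> iκ c; have [[k ck] [k' ck']] := class_climbs (infinite_ord iκ) c.
have iμ := class_infinite iκ c.
by split; [apply: EC_climbs ck | apply: EC_climbs ck'];
  apply: infinite_limit_ordinal || apply: infinite_ord.
Qed.

End Cofinality.

(** * Limit cardinals of a given cofinality *)

Section LimitCardinals.
Implicit Types (x y z a b m n p q s A B X Y α β γ δ κ μ τ θ η ξ : V).

(** Cofinal maps to [κ] are pushed forward by [f]; those to [μ] are pulled back by
    sending an ordinal to the first index where [f] reaches it. *)
Lemma cofinal_increasing κ μ (f : V -> V) γ : is_ordinal κ -> is_ordinal μ ->
  fdef1 f -> maps f κ μ ->
  (forall x y, x ∈ κ -> y ∈ κ -> x ∈ y -> f x ∈ f y) ->
  (forall ξ, ξ ∈ μ -> exists x, x ∈ κ /\ ord_le ξ (f x)) ->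
  (exists g, is_cofinal_map g γ κ) <-> (exists g, is_cofinal_map g γ μ).
Proof.
move=> oκ oμ df mf incr cf; rewrite !cofinal_mapP.
have mono x y : x ∈ κ -> y ∈ κ -> ord_le x y -> ord_le (f x) (f y).
  by move=> xκ yκ [xy|->]; [left; apply: incr | right].
have ofx x : x ∈ κ -> is_ordinal (f x) by move/mf; apply: ord_elt.
split=> -[g [dg mg cg]].
  exists (fun x => f (g x)); split; first by definable.
    by move=> x xγ; apply/mf/mg.
  move=> ξ /cf [x [xκ le]]; have [δ [δγ le']] := cg x xκ; exists δ; split=> //.
  by apply: ord_le_trans le (mono _ _ _ (mg _ δγ) le') => //; apply/ofx/mg.
pose h δ := least (fun x => x ∈ κ /\ ord_le (g δ) (f x)).
have hP δ : δ ∈ γ -> h δ ∈ κ /\ ord_le (g δ) (f (h δ)).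
  move=> δγ; have [||_ []//] := @leastP (fun x => x ∈ κ /\ ord_le (g δ) (f x)).
    by definable.
  by have [x [xκ le]] := cf _ (mg _ δγ); exists x; split=> //; apply: ord_elt xκ.
exists h; split; first by rewrite /h; definable.
  by move=> δ /hP [].
move=> x xκ; have [δ [δγ le]] := cg _ (mf _ xκ); exists δ; split=> //.
have [hκ le'] := hP δ δγ.
apply: ord_notin_le; [exact: ord_elt xκ | exact: ord_elt hκ |] => hx.
have := ord_le_trans (ofx _ hκ) le le'.
by move/ord_le_notin; apply; apply: incr.
Qed.

(** The supremum of the first [κ] cardinals above [α], enumerated by iterating
    the Hartogs number along [κ]. *)
Lemma limit_cardinal_above κ α : infinite_cardinal κ -> is_ordinal α ->
  exists μ, [/\ in_cof_class κ μ, limit_cardinal μ & ord_le α μ].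
Proof.
move=> iκ oα; have [oκ [x0 x0κ] lκ] := infinite_limit_ordinal iκ.
pose G s := hartogs (cup (bigU s) α).
have dG : fdef1 G by rewrite /G; definable.
have tκ : transitive_on κ (@elt V).
  by move=> x y z _ _ zκ; apply/ord_trans/(ord_elt oκ).
have [f [df fE]] := wf_recursion def_elt dG tκ (well_founded_elt (A := κ)).
have cf x : x ∈ κ -> is_cardinal (f x).
  by move=> xκ; rewrite fE //; apply: Hartogs_cardinal (hartogsP _).
have of_ x : x ∈ κ -> is_ordinal (f x) by case/cf.
have αf x : x ∈ κ -> α ∈ f x.
  move=> xκ; rewrite fE //; apply: lt_hartogs => //; apply: card_le_subset => z.
  by rewrite in_cup; right.
have incr x y : x ∈ κ -> y ∈ κ -> x ∈ y -> f x ∈ f y.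
  move=> xκ yκ xy; rewrite (fE y) //; apply: lt_hartogs; first exact: of_.
  apply: card_le_subset => z zf; rewrite in_cup in_bigU; left; exists (f x).
  split=> //; apply/in_img => //; exists x; split=> //.
  by apply/in_sep => //; definable.
pose μ := bigU (img κ f).
have inμ z : z ∈ μ <-> exists x, x ∈ κ /\ z ∈ f x.
  rewrite in_bigU; split=> [[w [/in_img-/(_ df) [x [xκ ->]] zf]]|[x [xκ zf]]].
    by exists x.
  by exists (f x); split=> //; apply/in_img => //; exists x.
have fμ x : x ∈ κ -> f x ∈ μ.
  by move=> xκ; apply/inμ; exists (suc x); split; [|apply: incr; auto; apply: mem_suc]; apply: lκ.
have oμ : is_ordinal μ by apply: ord_bigU => z /in_img-/(_ df) [x [xκ ->]]; apply: of_.
have cμ : is_cardinal μ.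
  apply: cardinalI => // γ /inμ [x [xκ γf]] le.
  apply: (cardinal_not_le (cf x xκ) γf); apply: card_le_trans le.
  by apply/card_le_subset/ord_le_sub => //; left; apply: fμ.
exists μ; split.
- split=> //; have [θ [oθ cθ mθ]] := is_cof_exists oκ.
  have E γ : (exists g, is_cofinal_map g γ κ) <-> (exists g, is_cofinal_map g γ μ).
    apply: (cofinal_increasing _ oκ oμ df fμ incr) => ξ /inμ [x [xκ ξf]].
    by exists x; split=> //; left.
  exists θ; split; split=> //; first exact/E.
  by move=> β oβ /E; apply: mθ.
- have lim γ : γ ∈ μ -> exists x, [/\ x ∈ κ, f x ∈ μ & γ ∈ f x].
    by move=> /inμ [x [xκ γf]]; exists x; split=> //; apply: fμ.
  split; last by move=> γ /lim [x [xκ fxμ γf]] _; exists (f x); split=> //; apply: cf.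
  apply: limit_infinite => //; first by exists (f x0); apply: fμ.
  move=> γ /lim [x [xκ fxμ γf]]; apply: ord_le_lt_trans fxμ => //.
  by apply: suc_le => //; apply: of_.
- by left; apply: ord_trans (αf _ x0κ) (fμ _ x0κ).
Qed.

End LimitCardinals.

(** * Hartogs numbers and the failure of extendable choice *)

Section Hartogs.
Implicit Types (x y z a b m n p q A B X Y α β γ δ κ μ ν τ θ η ξ : V).

(** The family of the sets of injections of [β] into [Y], for [β] in [μ], is
    approachable: one injection restricts to all smaller ordinals. *)
Lemma uniform_injections μ Y : is_ordinal μ -> EC μ ->
  (forall β, β ∈ μ -> card_le β Y) ->
  exists s : V -> V, fdef1 s /\
    forall β, β ∈ μ -> maps (ap (s β)) β Y /\ inj_on (ap (s β)) β.
Proof.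
move=> oμ /(ECP (proj1 oμ)) H le.
pose I β i := maps (ap i) β Y /\ inj_on (ap i) β.
have dI β : def1 (I β) by rewrite /I /maps /inj_on; definable.
pose F β := sep (pow (cross μ Y)) (I β).
have inF β i : i ∈ F β <-> i ∈ pow (cross μ Y) /\ I β i by apply: in_sep.
have dF : fdef1 F by rewrite /F /I /maps /inj_on; definable.
have ne β : β ∈ μ -> exists i, forall γ, ord_le γ β -> i ∈ F γ.
  move=> βμ; have oβ := ord_elt oμ βμ.
  have [i [di mi ii]] := card_leE (le β βμ).
  exists (lam β i) => γ γβ; have γsub := ord_le_sub oβ γβ; apply/inF; split.
    apply/in_pow => z /in_lam-/(_ di) [x [xβ ->]]; apply/opair_cross.
    by split; [apply: ord_trans βμ | apply: mi].
  split=> [x /γsub xβ|x y /γsub xβ /γsub yβ]; first by rewrite ap_lam //; apply: mi.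
  by rewrite !ap_lam //; apply: ii.
have [//|β βμ|β βμ|s [ds sF]] := H F.
- by have [i Hi] := ne β βμ; exists i; apply: Hi; right.
- have [i Hi] := ne β βμ; exists (fun=> i); split=> [|γ γβ]; first by definable.
  by apply: Hi; left.
- by exists s; split=> // β /sF /inF [].
Qed.

(** Injections into [X] of all ordinals below [μ], chosen simultaneously, have a
    well-orderable union of ranges. Each cardinal below the limit cardinal [μ]
    injects into this union, so [μ] does too, contrary to its being the Hartogs
    number of [X]. *)
Lemma Hartogs_limit_not_EC X μ : limit_cardinal μ -> is_Hartogs X μ -> ~ EC μ.
Proof.
move=> [iμ lμ] HX ec; have oμ := infinite_ord iμ; have [_ nX _] := HX.
have [s [ds sP]] := uniform_injections oμ ec (fun β => Hartogs_card_le HX (α := β)).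
have [_ nfμ] := iμ; have [j [dj mj ij]] := card_leE (hessenberg oμ nfμ).
pose e p := ap (s (pr1 p)) (pr2 p).
have de : fdef1 e by rewrite /e; definable.
pose D := sep (cross μ μ) (fun p => pr2 p ∈ pr1 p).
have inD p : p ∈ D <-> p ∈ cross μ μ /\ pr2 p ∈ pr1 p by apply: in_sep; definable.
have DX : maps e D X.
  move=> p /inD [/in_cross [β [γ [βμ γμ ->]]]]; rewrite /e pr1E pr2E => γβ.
  by have [ms _] := sP β βμ; apply: ms.
have [τ [oτ τμ eτ]] : exists τ, [/\ is_ordinal τ, ord_le τ μ & card_eq τ (img D e)].
  apply: card_eq_le_ord => //.
  (* Code a value of [e] by the least code of a pair that produces it. *)
  pose c x := least (fun ξ => exists p, [/\ p ∈ D, e p = x & j p = ξ]).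
  have cP x : x ∈ img D e -> exists p, [/\ p ∈ D, e p = x & j p = c x].
    move=> /in_img-/(_ de) [p [pD ->]].
    have [||_ //] := @leastP (fun ξ => exists q, [/\ q ∈ D, e q = e p & j q = ξ]).
      by rewrite /D; definable.
    by exists (j p); split; [apply/(ord_elt oμ)/mj; case/inD: pD | exists p].
  apply: (@card_leI _ _ c).
  - by rewrite /c /D; definable.
  - by move=> x /cP [p [/inD [/mj + _] _ <-]].
  - move=> x y /cP [p [/inD [pD _] <- Ep]] /cP [q [/inD [qD _] <- Eq]] E.
    by rewrite (ij p q) // Ep Eq.
have τX : card_le τ X.
  apply: card_le_trans (card_eq_le eτ) _; apply: card_le_subset.
  by move=> z /in_img-/(_ de) [p [pD ->]]; apply: DX.
case: τμ => [τμ|E]; last by apply: nX; rewrite -E.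
have [κ [cκ κτ eκ]] := cardinality oτ.
have [η [ημ cη κη]] := lμ κ (ord_le_lt_trans oμ κτ τμ) cκ.
apply: (cardinal_not_le cη κη); apply: card_le_trans (card_eq_ge eκ).
apply: card_le_trans (card_eq_ge eτ); have [_ is_] := sP η ημ.
apply: (@card_leI _ _ (ap (s η))); [by definable| |by []].
move=> γ γη; apply/in_img => //; exists (opair η γ); rewrite /e pr1E pr2E.
split=> //; apply/inD; rewrite pr1E pr2E; split=> //.
by apply/opair_cross; split=> //; apply: ord_trans ημ.
Qed.

(** When [μ] is the successor of [ρ], choose along [μ] both points of [X] with
    cofinal images in [μ] and injections into [ρ]. If the cofinal set of images has
    the size of [μ], then [μ] injects into [X]; otherwise [μ] is a union of at
    most [ρ] sets that inject uniformly into [ρ], hence no larger than [ρ].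
    Without choice a successor cardinal may be singular; the second case shows
    that [EC μ] fails then. *)
Lemma Hartogs_Lindenbaum_not_EC X μ ν : infinite_cardinal μ ->
  is_Hartogs X μ -> is_Lindenbaum X ν -> μ ∈ ν -> ~ EC μ.
Proof.
move=> iμ HX [oν _ mν] μν ec; have oμ := infinite_ord iμ; have [_ nX _] := HX.
have [lμ|nlμ] := classic (limit_cardinal μ); first exact: (Hartogs_limit_not_EC lμ HX).
have [ρ [lμ cρ lmax]] : exists l, [/\ l ∈ μ, is_cardinal l &
    forall κ, κ ∈ μ -> is_cardinal κ -> ~ l ∈ κ].
  apply: NNPP => n; apply: nlμ; split=> // l lμ cl; apply: NNPP => n'; apply: n.
  by exists l; split=> // κ κμ cκ lκ; apply: n'; exists κ.
have below_ρ β : β ∈ μ -> card_le β ρ.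
  move=> βμ; have [κ [cκ κβ eκ]] := cardinality (ord_elt oμ βμ).
  apply: card_le_trans (card_eq_ge eκ) _; apply/card_le_subset/ord_le_sub.
    by case: cρ.
  apply: ord_notin_le (lmax _ _ cκ); first by case: cκ.
    by case: cρ.
  exact: ord_le_lt_trans κβ βμ.
have [s [ds sP]] := uniform_injections oμ ec below_ρ.
have [_ [x0 x0μ] sucμ] := infinite_limit_ordinal iμ.
have [f [df mf of_]] : exists f, [/\ fdef1 f, maps f X μ & onto f X μ].
  apply: (card_le_starE x0μ); apply: NNPP => nle.
  by apply: (ord_le_notin (mν μ oμ nle)).
have [x [dx xP]] : exists x : V -> V, fdef1 x /\
    forall β, β ∈ μ -> x β ∈ X /\ ord_le β (f (x β)).
  pose F β := sep X (fun x => ord_le β (f x)).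
  have inF β y : y ∈ F β <-> y ∈ X /\ ord_le β (f y) by apply: in_sep; definable.
  have [||β βμ|x [dx xF]] := proj1 (ECP (proj1 oμ)) ec F.
  - by rewrite /F; definable.
  - by move=> β /of_ [y [yX E]]; exists y; apply/inF; split=> //; rewrite E; right.
  - have [y [yX E]] := of_ β βμ; exists (fun=> y); split=> [|γ γβ]; first by definable.
    by apply/inF; split=> //; rewrite E; left.
  - by exists x; split=> // β /xF /inF.
pose g β := f (x β); have dg : fdef1 g by rewrite /g; definable.
pose B := img μ g.
have inB b : b ∈ B <-> exists β, β ∈ μ /\ b = g β by apply: in_img.
have Bμ : Defs.subset B μ by move=> b /inB [β [/xP [xX _] ->]]; apply: mf.
have [τ [oτ τμ eτ]] := card_eq_sub_ord oμ Bμ.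
case: τμ => [τμ|E].
  have [l [dl ml il]] := card_leE (card_le_trans (card_eq_ge eτ) (below_ρ τ τμ)).
  pose b ξ := least (fun b => b ∈ B /\ ξ ∈ b).
  have bP ξ : ξ ∈ μ -> b ξ ∈ B /\ ξ ∈ b ξ.
    move=> /sucμ ξμ; have [||_ []//] := @leastP (fun b => b ∈ B /\ ξ ∈ b).
      by definable.
    have gB : g (suc ξ) ∈ B by apply/inB; exists (suc ξ).
    exists (g (suc ξ)); split; first exact: ord_elt (Bμ _ gB).
    split=> //; apply: ord_lt_le_trans (mem_suc ξ) (proj2 (xP _ ξμ)).
    exact: ord_elt (Bμ _ gB).
  apply: (cardinal_square_lt iμ lμ).
  apply: (@card_leI _ _ (fun ξ => opair (l (b ξ)) (ap (s (b ξ)) ξ))).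
  - by rewrite /b; definable.
  - move=> ξ /bP [bB ξb]; apply/opair_cross; split; first exact: ml.
    by have [ms _] := sP _ (Bμ _ bB); apply: ms.
  - move=> ξ ξ' /bP [bB ξb] /bP [bB' ξb'] /opair_inj [/il E1 E2].
    rewrite -E1 // in ξb' E2; have [_ is_] := sP _ (Bμ _ bB).
    exact: is_.
apply: nX; rewrite -{1}E; apply: card_le_trans (card_eq_le eτ) _.
pose t b := least (fun β => β ∈ μ /\ g β = b).
have tP b : b ∈ B -> t b ∈ μ /\ g (t b) = b.
  move=> /inB [β [βμ ->]]; have [||_ //] := @leastP (fun γ => γ ∈ μ /\ g γ = g β).
    by definable.
  by exists β; split=> //; apply: ord_elt βμ.
apply: (@card_leI _ _ (fun b => x (t b))).
- by rewrite /t; definable.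
- by move=> b /tP [/xP []].
- by move=> b b' /tP [_ {2}<-] /tP [_ {2}<-] Ex; rewrite /g Ex.
Qed.

(** The set behind a failure of [EC κ], for an approachable [F] without selector
    and a map [k] climbing from [κ] to [μ]: partial selectors on initial segments
    up to [β], each with [k β] labels. The labels make room for all ordinals below
    [μ]. An injection of [μ] itself would meet only a bounded set of [β]s, since
    unboundedly many of its well-ordered partial selectors would yield a selector;
    hence its labels are bounded below [μ], and so, for [μ] large, is the number of
    partial selectors. *)
Lemma not_EC_Hartogs κ : infinite_cardinal κ -> ~ EC κ ->
  exists α, is_ordinal α /\ forall μ, in_cof_class κ μ -> ord_le α μ ->
    exists X, is_Hartogs X μ /\ card_le_star μ X.
Proof.
move=> iκ nec; have lκ := infinite_limit_ordinal iκ; have [oκ [x0 x0κ] sucκ] := lκ.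
have [F [dF nF aF nsF]] : exists F : V -> V, [/\ fdef1 F,
    forall β, β ∈ κ -> nonempty (F β),
    forall β, β ∈ κ -> exists s : V -> V, fdef1 s /\ forall γ, γ ∈ β -> s γ ∈ F γ
  & ~ exists s : V -> V, fdef1 s /\ forall β, β ∈ κ -> s β ∈ F β].
  apply: NNPP => n; apply/nec/ECP; first by case: oκ.
  by move=> F dF nF aF; apply: NNPP => ns; apply: n; exists F.
pose Q := cross κ (pow (cross κ (bigU (img κ F)))).
exists (hartogs Q); have [oh nh _] := hartogsP Q; split=> // μ cμ hμ.
have iμ := class_infinite iκ cμ; have oμ := infinite_ord iμ.
have [_ _ sucμ] := infinite_limit_ordinal iμ.
have [_ [k [dk mk ik ck]]] := class_climbs oκ cμ.
have dS := fdef_selectors κ dF.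
have Sne β : β ∈ κ -> nonempty (selectors κ F β) by apply: selectors_nonempty.
pose X := sep (cross Q μ) (fun z =>
  pr2 (pr1 z) ∈ selectors κ F (pr1 (pr1 z)) /\ pr2 z ∈ k (pr1 (pr1 z))).
have inX β s ξ : opair (opair β s) ξ ∈ X <->
    [/\ β ∈ κ, s ∈ selectors κ F β & ξ ∈ k β].
  rewrite /X in_sep; last by definable.
  rewrite !pr1E !pr2E !opair_cross; split=> [[[[? ?] ?] [? ?]] //|[βκ sS ξk]].
  split=> //; split; last by apply: ord_trans (mk _ βκ).
  by split=> //; move/in_selectors: sS => /(_ dF) [].
have Xpair z : z ∈ X -> exists β s ξ, z = opair (opair β s) ξ.
  rewrite /X in_sep; last by definable.
  move=> [/in_cross [q [ξ [/in_cross [β [s [_ _ ->]]] _ ->]]] _].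
  by exists β, s, ξ.
have above β : β ∈ μ -> exists δ s, [/\ δ ∈ κ, ord_le β (k δ) & s ∈ selectors κ F δ].
  by move=> /ck [δ [δκ le]]; have [s sS] := Sne δ δκ; exists δ, s.
exists X; split; last first.
  apply: (@card_le_starI _ _ pr2); first by definable.
    move=> z zX; have [β [s [ξ E]]] := Xpair z zX; move: zX; rewrite E pr2E.
    by move=> /inX [βκ _ ξk]; apply: ord_trans (mk _ βκ).
  move=> ξ /sucμ /above [δ [s [δκ le sS]]].
  exists (opair (opair δ s) ξ); rewrite pr2E; split=> //; apply/inX; split=> //.
  by apply: ord_lt_le_trans (mem_suc ξ) le; apply: ord_elt (mk _ δκ).
split=> // [|β oβ nβ]; last first.
  apply: ord_notin_le => // /above [δ [s [δκ le sS]]]; apply: nβ.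
  apply: (@card_leI _ _ (fun ξ => opair (opair δ s) ξ)); first by definable.
    move=> ξ ξβ; apply/inX; split=> //.
    by apply: ord_lt_le_trans ξβ le; apply: ord_elt (mk _ δκ).
  by move=> ξ ξ' _ _ /opair_inj [].
move=> /card_leE [i [di mi ii]].
pose a ξ := pr1 (i ξ); have da : fdef1 a by rewrite /a; definable.
have iE ξ : ξ ∈ μ -> i ξ = opair (opair (pr1 (a ξ)) (pr2 (a ξ))) (pr2 (i ξ)).
  move=> /mi /Xpair [β [s [η E]]]; rewrite /a E.
  by rewrite !pr1E !pr2E.
have iP ξ : ξ ∈ μ -> [/\ pr1 (a ξ) ∈ κ, pr2 (a ξ) ∈ selectors κ F (pr1 (a ξ))
    & pr2 (i ξ) ∈ k (pr1 (a ξ))].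
  by move=> ξμ; apply/inX; rewrite -iE //; apply: mi.
have [γ0 [γ0κ bounded]] : exists γ, γ ∈ κ /\ forall ξ, ξ ∈ μ -> ord_le (pr1 (a ξ)) γ.
  apply: NNPP => unb; apply: nsF.
  pose t γ := least (fun ξ => ξ ∈ μ /\ γ ∈ pr1 (a ξ)).
  exists (fun γ => ap (pr2 (a (t γ))) γ); split; first by rewrite /t; definable.
  move=> γ γκ; have [||_ [tμ lt] _] := @leastP (fun ξ => ξ ∈ μ /\ γ ∈ pr1 (a ξ)).
  - by definable.
  - apply: NNPP => n; apply: unb; exists γ; split=> // ξ ξμ.
    have [bκ _ _] := iP ξ ξμ.
    apply: ord_notin_le; [exact: ord_elt bκ | exact: ord_elt γκ | move=> lt].
    by apply: n; exists ξ; split=> //; apply: ord_elt ξμ.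
  - have [_ /in_selectors-/(_ dF) [_ sel] _] := iP _ tμ.
    by apply: sel => //; left.
have Aμ : card_le (img μ a) μ.
  pose t y := least (fun ξ => ξ ∈ μ /\ a ξ = y).
  have tP y : y ∈ img μ a -> t y ∈ μ /\ a (t y) = y.
    move=> /in_img-/(_ da) [ξ [ξμ ->]].
    have [||_ //] := @leastP (fun η => η ∈ μ /\ a η = a ξ); first by definable.
    by exists ξ; split=> //; apply: ord_elt ξμ.
  apply: (@card_leI _ _ t); [by rewrite /t; definable | by move=> y /tP [] |].
  by move=> y y' /tP [_ {2}<-] /tP [_ {2}<-] ->.
have [τ [oτ τμ eτ]] := card_eq_le_ord oμ Aμ.
have aQ ξ : ξ ∈ μ -> a ξ ∈ Q.
  move=> /mi; rewrite /a in_sep; last by definable.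
  by move=> [/in_cross [q [η [qQ _ ->]]] _]; rewrite pr1E.
have AQ : card_le (img μ a) Q.
  by apply: card_le_subset => y /in_img-/(_ da) [ξ [/aQ ? ->]].
case: τμ => [τμ|E]; last first.
  apply: nh; apply: card_le_trans AQ; apply: card_le_trans (card_eq_le eτ).
  by rewrite E; apply/card_le_subset/ord_le_sub.
have [l [dl ml il]] := card_leE (card_eq_ge eτ).
have aA ξ : ξ ∈ μ -> a ξ ∈ img μ a by move=> ξμ; apply/in_img => //; exists ξ.
have kμ := mk _ γ0κ; have ok := ord_elt oμ kμ.
apply: (cardinal_square_lt iμ (cup_lub oμ τμ kμ)).
apply: (@card_leI _ _ (fun ξ => opair (l (a ξ)) (pr2 (i ξ)))); first by definable.
  move=> ξ ξμ; have [bκ _ ξk] := iP ξ ξμ; apply/opair_cross; rewrite !in_cup.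
  split; first by left; apply/ml/aA.
  right; apply: ord_lt_le_trans ξk _ => //.
  by apply: ik => //; apply: bounded.
move=> ξ ξ' ξμ ξμ' /opair_inj [/il E1 E2]; apply: ii => //.
have Ea := E1 (aA _ ξμ) (aA _ ξμ').
by rewrite (iE ξ) // (iE ξ') // Ea E2.
Qed.

End Hartogs.

End ZFSetTheory.

(** * Equivalence of the six clauses *)

Theorem corollary1p8 (V : set_structure) (hV : ZF V)
    (κ : V) (hκ : infinite_cardinal κ) :
  [<-> ~ EC κ;
       forall μ : V, in_cof_class κ μ -> ~ EC μ;
       exists μ : V, in_cof_class κ μ /\ ~ EC μ;
       exists μ X : V, [/\ in_cof_class κ μ, limit_cardinal μ & is_Hartogs X μ];
       exists μ X ν : V, [/\ in_cof_class κ μ, is_Hartogs X μ,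
                             is_Lindenbaum X ν & μ ∈ ν];
       exists μ' : V, in_cof_class κ μ' /\
         forall μ : V, in_cof_class κ μ -> limit_cardinal μ -> ord_le μ' μ ->
           exists X : V, is_Hartogs X μ].
Proof.
have cκ : is_cardinal κ by case: hκ.
have ECκ μ : in_cof_class κ μ -> EC μ <-> EC κ by apply: EC_class.
have large : ~ EC κ -> exists μ', [/\ in_cof_class κ μ', limit_cardinal μ' &
    forall μ, in_cof_class κ μ -> ord_le μ' μ ->
      exists X, is_Hartogs X μ /\ card_le_star μ X].
  move=> /(not_EC_Hartogs hV hκ) [α [oα H]].
  have [μ' [cμ' lμ' αμ']] := limit_cardinal_above hV hκ oα.
  exists μ'; split=> // μ cμ le; apply: H => //.
  by apply: ord_le_trans αμ' le; case: cμ => -[].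
have from4 : (exists μ X, [/\ in_cof_class κ μ, limit_cardinal μ & is_Hartogs X μ]) ->
    ~ EC κ.
  by move=> [μ [X [cμ lμ /(Hartogs_limit_not_EC hV lμ)]]]; rewrite ECκ.
tfae.
- by move=> n μ cμ; rewrite ECκ.
- by move=> n; exists κ; split; [apply: class_refl | apply/n/class_refl].
- move=> [μ [cμ]]; rewrite (ECκ μ cμ) => /large [μ' [cμ' lμ' H]].
  by have [|X [HX _]] := H μ' cμ'; [right | exists μ', X].
- move=> /from4 /large [μ [cμ lμ H]].
  have [|X [HX sX]] := H μ cμ; first by right.
  have oμ : is_ordinal μ by case: cμ => -[].
  have [ν HL] := Lindenbaum_exists hV X; exists μ, X, ν; split=> //.
  exact: (Lindenbaum_gt hV HL).
- move=> [μ [X [ν [cμ HX HL μν]]]]; have iμ := class_infinite hV hκ cμ.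
  have /large [μ' [cμ' lμ' H]] : ~ EC κ.
    by rewrite -(ECκ μ cμ); apply: Hartogs_Lindenbaum_not_EC HL μν.
  by exists μ'; split=> // ξ cξ _ le; have [X' [HX' _]] := H ξ cξ le; exists X'.
- move=> [μ' [cμ' H]]; apply: from4.
  have oμ' : is_ordinal μ' by case: cμ' => -[].
  have [μ [cμ lμ le]] := limit_cardinal_above hV hκ oμ'.
  by have [X HX] := H μ cμ lμ le; exists μ, X.
Qed.
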